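(* (Supertropical Nullstellensatz) Let $F$ be a divisibly closed, archimedean supertropical semifield, let $\Lambda=\{\lambda_1,\dots,\lambda_n\}$, let $A$ be a semiring ideal of $F[\Lambda]$, and let $f\in F[\Lambda]$. Then $$f\preceq_{\mathrm{comp}} A \quad\text{if and only if}\quad f\in \sqrt[\mathrm{trop}]{A}.$$
   Context: All semirings are commutative (in both operations), with zero $0_R$ and unit $1_R$. A supertropical semiring is a triple $(R,\mathcal G_0,\nu)$ where $R$ is a semiring, $\mathcal G_0=\mathcal G\cup\{0_R\}$ is a semiring ideal of $R$ (the ghost ideal; its elements are ghosts), and $\nu:R\to\mathcal G_0$ (written $a^\nu=\nu(a)$) is a semiring homomorphism with $\nu^2=\nu$ (where $\mathcal G_0$ is a semiring with unit $\nu(1_R)$), such that: $a+a=a^\nu$ for all $a$; $a+b\in\{a,b\}$ whenever $a^\nu\ne b^\nu$; and $a+b=a^\nu$ whenever $a^\nu=b^\nu$. $\mathcal G_0$ is totally ordered by $g\ge h\iff g+h=g$; write $a>_\nu b$ for $a^\nu>b^\nu$, $a\ge_\nu b$ for $a^\nu\ge b^\nu$, and $a\cong_\nu b$ for $a^\nu=b^\nu$. It is a supertropical domain if the set $\mathcal T=R\setminus\mathcal G_0$ of tangible elements is a multiplicative monoid and $\nu|_{\mathcal T}:\mathcal T\to\mathcal G$ is onto; it is a supertropical semifield if moreover $\mathcal T$ is an Abelian group. Put $\mathcal T_0=\mathcal T\cup\{0_R\}$. The divisible closure $\bar R$ of a supertropical domain $R$ consists of formal roots $\sqrt[m]{a}$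 ($a\in R$, $m\ge1$), with $\sqrt[m]{a}=\sqrt[m']{b}$ when $a^{m'n}=b^{mn}$ for some $n\ge 1$, product $\sqrt[m]{a}\sqrt[m']{b}=\sqrt[mm']{a^{m'}b^m}$, sum $\sqrt[m]{a}+\sqrt[m']{b}=\sqrt[mm']{a^{m'}+b^m}$, and $\nu(\sqrt[m]{a})=\sqrt[m]{a^\nu}$. $R$ is divisibly closed if $\bar R=R$ (identifying $a$ with $\sqrt[1]{a}$). $F$ is archimedean if for all $a,b\in F$ with $a>_\nu 1_F$ there is $m$ with $a^m>_\nu b$. $F[\Lambda]$ is the semiring of functions $F^{(n)}\to F$ defined by polynomials $\sum_{\mathbf i}\alpha_{\mathbf i}\Lambda^{\mathbf i}$ with coefficients in $F$ (pointwise operations; two polynomials defining the same function are identified). A monomial $h$ of a polynomial $f$ is essential if there is a point $\mathbf a$ at which $h(\mathbf a)>_\nu f_h(\mathbf a)$, where $f_h$ is the sum of the other monomials of $f$. Every element of $F[\Lambda]$ is represented by an essential polynomial (one all of whose monomials are essential). The ghost ideal of $F[\Lambda]$ consists of the elements all of whose values are in $\mathcal G_0$ (equivalently, which are represented by polynomials with coefficients in $\mathcal G_0$). Write $f=\sum_{\mathbf i} f_{\mathbf i}$ as the sum of its (essential) monomials. The component of $f$ associated with $f_{\mathbf i}$ is $D_{f,\mathbf i}=\{\mathbf a\in\mathcal T_0^{(n)}: f(\mathbf a)=f_{\mathbf i}(\mathbf a)\in\mathcal T\}$. Write $f\preceq_{D_{f,\mathbf i}} g$ if $g(D_{f,\mathbf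 i})\subseteq\mathcal T$. For $S\subseteq F[\Lambda]$ write $f\preceq_{\mathrm{comp}}S$ if for every essential monomial $f_{\mathbf i}$ of $f$ there is $g\in S$ (depending on $\mathbf i$) with $f\preceq_{D_{f,\mathbf i}}g$. In a semiring with ghosts, $b$ supertropically divides $a$ if $a=qb+c$ for some element $q$ and some ghost element $c$ (in the ghost ideal). The supertropical radical $\sqrt[\mathrm{trop}]{A}$ is the set of $a$ such that some power $a^k$ ($k\ge1$) is supertropically divisible by an element of $A$. *)

(* Defs.v *)
From HB Require Import structures.
From mathcomp Require Import all_boot all_algebra.
From mathcomp Require Import generic_quotient finmap mpoly.
From mathcomp Require Import boolp classical_sets functions.

Set Implicit Arguments.
Unset Strict Implicit.
Unset Printing Implicit Defensive.

Import GRing.Theory.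

Local Open Scope ring_scope.
Local Open Scope classical_set_scope.
Local Open Scope quotient_scope.

Definition semiring_ideal (R : comPzSemiRingType) (I : set R) : Prop :=
  [/\ I 0,
      forall a b, I a -> I b -> I (a + b)
    & forall r a, I a -> I (r * a)].

(* [ghost] is the ghost ideal, zero included. The four axioms [nu0], [nuD],   *)
(* [nuM] and [nu1_ghost] say that [nu] is a semiring homomorphism into the    *)
(* semiring [ghost], whose unit is [nu 1] rather than [1].                    *)
HB.mixin Record isSupertropical R of GRing.ComPzSemiRing R := {
  ghost : set R;
  nu : R -> R;
  ghost_ideal : semiring_ideal ghost;
  nu_ghost : forall a, ghost (nu a);
  nu0 : nu 0 = 0;
  nuD : forall a b, nu (a + b) = nu a + nu b;
  nuM : forall a b, nu (a * b) = nu a * nu b;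
  nu1_ghost : forall g, ghost g -> nu 1 * g = g;
  nu_idem : forall a, nu (nu a) = nu a;
  addrr_nu : forall a, a + a = nu a;
  addr_bipotent : forall a b, nu a <> nu b -> a + b = a \/ a + b = b;
  addr_eq_nu : forall a b, nu a = nu b -> a + b = nu a
}.

#[short(type="supertropicalType")]
HB.structure Definition Supertropical :=
  {R of isSupertropical R & GRing.ComPzSemiRing R}.

Definition tangible {R : supertropicalType} : set R := ~` ghost.

Definition tangible0 {R : supertropicalType} : set R := tangible `|` [set 0].

HB.mixin Record isSupertropicalDomain R of Supertropical R := {
  tangible1 : tangible (1 : R);
  tangibleM : forall a b : R, tangible a -> tangible b -> tangible (a * b);
  nu_tangible : nu @` (tangible : set R) = ghost `\ 0
}.

#[short(type="supertropicalDomainType")]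
HB.structure Definition SupertropicalDomain :=
  {R of isSupertropicalDomain R & Supertropical R}.

HB.mixin Record isSupertropicalSemifield R of SupertropicalDomain R := {
  tangibleV : forall a : R, tangible a -> exists2 b, tangible b & a * b = 1
}.

#[short(type="supertropicalSemifieldType")]
HB.structure Definition SupertropicalSemifield :=
  {R of isSupertropicalSemifield R & SupertropicalDomain R}.

Definition ge_nu (R : supertropicalType) (a b : R) : Prop :=
  nu a + nu b = nu a.

Definition gt_nu (R : supertropicalType) (a b : R) : Prop :=
  ge_nu a b /\ nu a <> nu b.

Definition archimedean (R : supertropicalType) : Prop :=
  forall a b : R, gt_nu a 1 -> exists m : nat, gt_nu (a ^+ m) b.

Section DivisibleClosure.
Variable R : supertropicalDomainType.

(* [(a, m)] stands for the formal m-th root of a. *)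
Definition formal_root : Type := (R * {m : nat | (0 < m)%N})%type.

Definition eq_root (x y : formal_root) : bool :=
  `[< exists2 n : nat, (0 < n)%N
      & x.1 ^+ (val y.2 * n) = y.1 ^+ (val x.2 * n) >].

Lemma eq_root_refl : reflexive eq_root.
Proof. by move=> x; apply/asboolP; exists 1%N. Qed.

Lemma eq_root_sym : ssrbool.symmetric eq_root.
Proof. by move=> x y; apply/asboolP/asboolP => -[k k0 e]; exists k. Qed.

Lemma eq_root_trans : transitive eq_root.
Proof.
move=> y x z /asboolP[k k0 exy] /asboolP[l l0 eyz]; apply/asboolP.
exists (val y.2 * k * l)%N; first by rewrite !muln_gt0 (valP y.2) k0.
transitivity ((x.1 ^+ (val y.2 * k)) ^+ (val z.2 * l)).
  by rewrite -exprM; congr (_ ^+ _); rewrite mulnCA !mulnA.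
rewrite exy -exprM.
transitivity ((y.1 ^+ (val z.2 * l)) ^+ (val x.2 * k)).
  by rewrite -exprM; congr (_ ^+ _); rewrite mulnC.
by rewrite eyz -exprM; congr (_ ^+ _); rewrite mulnC -!mulnA; congr muln;
   rewrite mulnCA.
Qed.

Canonical eq_root_equiv :=
  EquivRel eq_root eq_root_refl eq_root_sym eq_root_trans.

Definition divisible_closure : Type := {eq_quot eq_root}.

Definition root1 (a : R) : divisible_closure :=
  \pi_{eq_quot eq_root} (a, exist _ 1%N isT).

(* The operations of the divisible closure make [root1] a homomorphism, so    *)
(* the closure coincides with R as soon as [root1] is a bijection.            *)
Definition divisibly_closed : Prop := bijective root1.

End DivisibleClosure.

Section Polynomials.
Variables (F : comPzSemiRingType) (n : nat).

(* Multinomials' {mpoly F[n]} requires a ring of coefficients, so formal      *)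
(* polynomials are finitely supported families of coefficients.               *)
Definition polynomial : Type := {fsfun 'X_{1..n} -> F with 0}.

Definition mono_eval (c : F) (m : 'X_{1..n}) (a : 'I_n -> F) : F :=
  c * \prod_(i < n) a i ^+ m i.

Definition poly_eval (p : polynomial) (a : 'I_n -> F) : F :=
  \sum_(m <- finsupp p) mono_eval (p m) m a.

Definition is_polyfun : {pred ('I_n -> F) -> F} :=
  fun f => `[< exists p, f = poly_eval p >].

Lemma poly_eval_incl (S : {fset 'X_{1..n}}) (p : polynomial) a :
  (finsupp p `<=` S)%fset ->
  poly_eval p a = \sum_(m <- S) mono_eval (p m) m a.
Proof.
move=> sub; apply: big_fset_incl => // m _ pm.
by rewrite fsfun_dflt // /mono_eval mul0r.
Qed.

Lemma is_polyfun_mono c m : mono_eval c m \in is_polyfun.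
Proof.
apply/asboolP; exists [fsfun x in [fset m]%fset => c | 0]; apply/funext => a.
rewrite (@poly_eval_incl [fset m]%fset) ?finsupp_sub //.
by rewrite big_seq_fset1 fsfunE inE eqxx.
Qed.

Lemma is_polyfun0 : (0 : ('I_n -> F) -> F) \in is_polyfun.
Proof.
rewrite (_ : 0 = mono_eval 0 0%MM); first exact: is_polyfun_mono.
by apply/funext => a; rewrite /mono_eval mul0r.
Qed.

Lemma is_polyfunD : {in is_polyfun &, forall f g, f + g \in is_polyfun}.
Proof.
move=> _ _ /asboolP[p ->] /asboolP[q ->]; apply/asboolP.
pose S := (finsupp p `|` finsupp q)%fset.
exists [fsfun m in S => p m + q m | 0]; apply/funext => a.
rewrite [RHS](@poly_eval_incl S) ?finsupp_sub //.
rewrite [LHS]/GRing.add /= (@poly_eval_incl S p) ?fsubsetUl //.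
rewrite (@poly_eval_incl S q) ?fsubsetUr // -big_split /=.
rewrite big_seq [RHS]big_seq; apply: eq_bigr => m mS.
by rewrite fsfunE mS /mono_eval mulrDl.
Qed.

Fact is_polyfun_addr_closed : addr_closed is_polyfun.
Proof. by split; [exact: is_polyfun0 | exact: is_polyfunD]. Qed.

HB.instance Definition _ :=
  GRing.isAddClosed.Build (('I_n -> F) -> F) is_polyfun is_polyfun_addr_closed.

Lemma is_polyfun1 : (fun=> 1 : F) \in is_polyfun.
Proof.
rewrite (_ : (fun=> 1) = mono_eval 1 0%MM); first exact: is_polyfun_mono.
apply/funext => a; rewrite /mono_eval mul1r big1 // => i _.
by rewrite mnm0E expr0.
Qed.

Lemma is_polyfunM :
  {in is_polyfun &, forall f g, (fun a => f a * g a) \in is_polyfun}.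
Proof.
move=> _ _ /asboolP[p ->] /asboolP[q ->].
rewrite (_ : (fun a => _) = \sum_(m <- finsupp p) \sum_(k <- finsupp q)
    mono_eval (p m * q k) (m + k)%MM).
  by apply: rpred_sum => m _; apply: rpred_sum => k _; exact: is_polyfun_mono.
apply/funext => a; rewrite fct_sumE /= mulr_suml; apply: eq_bigr => m _.
rewrite fct_sumE mulr_sumr; apply: eq_bigr => k _.
rewrite /mono_eval mulrACA -big_split /=; congr (_ * _).
by apply: eq_bigr => i _; rewrite mnmDE exprD.
Qed.

(* The semiring F[Lambda] of polynomial functions. *)
Record polyfun : Type := Polyfun {
  polyfun_val :> ('I_n -> F) -> F;
  _ : is_polyfun polyfun_val
}.

HB.instance Definition _ := [isSub for polyfun_val].
HB.instance Definition _ := [Choice of polyfun by <:].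
HB.instance Definition _ :=
  GRing.SubChoice_isSubNmodule.Build _ is_polyfun polyfun is_polyfun_addr_closed.

Definition polyfun_one : polyfun := Polyfun is_polyfun1.

Definition polyfun_mul (f g : polyfun) : polyfun :=
  Polyfun (is_polyfunM (valP f) (valP g)).

Lemma polyfunP (f g : polyfun) : f =1 g -> f = g.
Proof. by move=> e; apply/val_inj/funext. Qed.

Fact polyfun_mulA : associative polyfun_mul.
Proof. by move=> f g h; apply/polyfunP => a /=; rewrite mulrA. Qed.

Fact polyfun_mulC : commutative polyfun_mul.
Proof. by move=> f g; apply/polyfunP => a /=; rewrite mulrC. Qed.

Fact polyfun_mul1 : left_id polyfun_one polyfun_mul.
Proof. by move=> f; apply/polyfunP => a /=; rewrite mul1r. Qed.

Fact polyfun_mulD : left_distributive polyfun_mul +%R.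
Proof. by move=> f g h; apply/polyfunP => a /=; rewrite mulrDl. Qed.

Fact polyfun_mul0 : left_zero 0 polyfun_mul.
Proof. by move=> f; apply/polyfunP => a /=; rewrite mul0r. Qed.

HB.instance Definition _ := GRing.Nmodule_isComPzSemiRing.Build polyfun
  polyfun_mulA polyfun_mulC polyfun_mul1 polyfun_mulD polyfun_mul0.

End Polynomials.

Notation "{ 'polyfun' F [ n ] }" := (polyfun F n)
  (at level 0, F at level 2, format "{ 'polyfun'  F [ n ] }") : type_scope.

Section Components.
Variables (F : supertropicalType) (n : nat).

Definition polyfun_ghost : set {polyfun F[n]} :=
  [set f | forall a, ghost (f a)].

Definition essential_in (p : polynomial F n) (m : 'X_{1..n}) : Prop :=
  m \in finsupp p /\
  exists a, gt_nu (mono_eval (p m) m a)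
                  (\sum_(k <- finsupp p | k != m) mono_eval (p k) k a).

(* The monomial c Lambda^m is an essential monomial of the function f. It is  *)
(* not required that f be representable with essential monomials only: this   *)
(* is impossible for f = lambda + 1 when F has no ghosts but 0 and nu 1.      *)
Definition essential_monomial (f : {polyfun F[n]}) (c : F) (m : 'X_{1..n}) :
    Prop :=
  exists p : polynomial F n,
    [/\ poly_eval p = f, p m = c & essential_in p m].

Definition component (f : {polyfun F[n]}) (c : F) (m : 'X_{1..n}) :
    set ('I_n -> F) :=
  [set a | [/\ forall i, tangible0 (a i),
               f a = mono_eval c m a
             & tangible (mono_eval c m a)]].

Definition preceq_on (D : set ('I_n -> F)) (g : {polyfun F[n]}) : Prop :=
  g @` D `<=` tangible.

Definition preceq_comp (f : {polyfun F[n]}) (S : set {polyfun F[n]}) : Prop :=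
  forall c m, essential_monomial f c m ->
    exists2 g, S g & preceq_on (component f c m) g.

End Components.

Section Radical.
Variables (R : comPzSemiRingType) (G : set R).

Definition super_divides (b a : R) : Prop :=
  exists q c : R, G c /\ a = q * b + c.

Definition trop_radical (A : set R) : set R :=
  [set a | exists2 k : nat, (0 < k)%N
         & exists2 b, A b & super_divides b (a ^+ k)].

End Radical.

(* Main.v *)
Require Import Defs.
From HB Require Import structures.
From mathcomp Require Import all_boot all_order all_algebra.
From mathcomp Require Import finmap mpoly.
From mathcomp Require Import generic_quotient.
From mathcomp Require Import boolp classical_sets.

(** For the implication from the radical to the components, suppose
    f^k = q b + c with c ghost.  Where f takes a tangible value so does
    q b + c, and this forces b to be tangible there, since ghosts form an
    ideal.  So b serves every component of f.

    For the converse, let h be an essential monomial of f with tangible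
    coefficient, and let g in A be tangible on the component of h.
    Wherever g is tangible, one of its monomials strictly dominates all the
    others in nu-value.  In logarithmic coordinates, with values in the
    divisible ordered group V of nonzero ghosts, the component is an open
    polyhedron and the ratios of monomials of g are affine forms on it.
    Moving inside the polyhedron, the dominating monomial of g can change
    only through a tie, where g would be ghost; so a single tangible
    monomial g0 dominates everywhere ([constant_dominator]).

    Now log g0 - log g1, for g1 another monomial of g, is an affine form
    which is positive on the polyhedron.  By Farkas' lemma it is a
    nonnegative rational combination of the forms log h - log h' that define
    the polyhedron, up to a nonnegative constant, and hence it is bounded
    below, everywhere, by a multiple of log h - log f ([positive_bound]).
    Exponentiating, h^j g1 <= f^j g0 in nu-value at all points.  Therefore
    q = h^j / g0, which is a monomial for j large, satisfies q g <= f^j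
    everywhere and q g = h^j where h dominates ([monomial_multiplier]).
    Farkas' lemma follows from Fourier-Motzkin elimination
    ([fourier_motzkin]), which works over any divisible ordered group because
    the linear parts of all forms have integer coefficients.

    It remains to add up.  Bring the exponents j to a common value k, by
    multiplying each q by a positive power of its h.  The sum of the
    resulting products q g is an element of A which agrees with f^k where a
    tangible monomial of f strictly dominates, and which is nowhere larger
    than f^k.  At all other points f is ghost, because it vanishes, or a
    monomial with ghost coefficient dominates, or two monomials tie; there f^k
    is supplied by the ghost polynomial [ghost_remainder], made of the k-th
    powers of the ghost monomials and of the mixed products h^(k-1) h'.

    Points with zero coordinates have no logarithm.  Strict inequalities
    between monomials persist when the zero coordinates are replaced by
    small nonzero elements ([perturbation]), so statements about such points
    are limits of statements about points with nonzero coordinates.  If V is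
    trivial there are no small elements, but then any two nonzero elements
    have the same nu-value, and only the supports of points and of monomials
    matter. *)

Set Implicit Arguments.
Unset Strict Implicit.
Unset Printing Implicit Defensive.

Import Order.POrderTheory GRing.Theory Num.Theory.

Local Open Scope classical_set_scope.
Local Open Scope ring_scope.

(** * Totally ordered abelian groups *)

HB.mixin Record isOrderedGroup V of Num.POrderedZmodule V := {
  le_total : forall x y : V, (x <= y) || (y <= x);
  leD2l : forall z x y : V, x <= y -> z + x <= z + y
}.

#[short(type="orderedGroupType")]
HB.structure Definition OrderedGroup :=
  {V of isOrderedGroup V & Num.POrderedZmodule V}.

Section OrderedGroup.
Context {V : orderedGroupType}.
Implicit Types (x y z t : V) (c e : bool).

Lemma leP x y : Order.le_xor_gt x y (Order.min y x) (Order.min x y)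
  (Order.max y x) (Order.max x y) (x <= y) (y < x).
Proof. exact/comparable_leP/le_total. Qed.

Lemma ltgtP x y : Order.compare x y (Order.min y x) (Order.min x y)
  (Order.max y x) (Order.max x y) (y == x) (x == y) (x >= y) (x <= y)
  (x > y) (x < y).
Proof. exact/comparable_ltgtP/le_total. Qed.

Lemma leNgt x y : (x <= y) = ~~ (y < x).
Proof. exact/comparable_leNgt/le_total. Qed.

Lemma ltNge x y : (x < y) = ~~ (y <= x).
Proof. exact/comparable_ltNge/le_total. Qed.

Lemma lteifNE x y c : x < y ?<= if ~~ c = ~~ (y < x ?<= if c).
Proof. exact/comparable_lteifNE/le_total. Qed.

Lemma leD2 z x y : (z + x <= z + y) = (x <= y).
Proof.
by apply/idP/idP => [/(leD2l (- z))|]; [rewrite !addKr | apply: leD2l].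
Qed.

Lemma ltD2 z x y : (z + x < z + y) = (x < y).
Proof. by rewrite !ltNge leD2. Qed.

Lemma lteifD2 z x y c : (z + x < z + y ?<= if c) = (x < y ?<= if c).
Proof. by case: c; rewrite /= ?leD2 ?ltD2. Qed.

Lemma leDl x y : (x + y <= x) = (y <= 0).
Proof. by rewrite -{2}[x]addr0 leD2. Qed.

Lemma leDr x y : (x + y <= y) = (x <= 0).
Proof. by rewrite addrC leDl. Qed.

Lemma ltDr x y : (x + y < y) = (x < 0).
Proof. by rewrite addrC -{2}[y]addr0 ltD2. Qed.

Lemma sub_lteif0 x y c : (0 < y - x ?<= if c) = (x < y ?<= if c).
Proof. by rewrite -(lteifD2 x 0) addr0 addrC subrK. Qed.

Lemma sub_gt0 x y : (0 < y - x) = (x < y).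
Proof. exact: (sub_lteif0 x y false). Qed.

Lemma sub_ge0 x y : (0 <= y - x) = (x <= y).
Proof. exact: (sub_lteif0 x y true). Qed.

Lemma lteif0D x y c e :
  0 < x ?<= if c -> 0 < y ?<= if e -> 0 < x + y ?<= if c && e.
Proof.
move=> x0 y0; apply: (lteif_trans x0).
by rewrite -{1}[x]addr0 lteifD2.
Qed.

Lemma opp_lteif0 x c : (0 < - x ?<= if c) = (x < 0 ?<= if c).
Proof. by rewrite -sub0r sub_lteif0. Qed.

Lemma lteif0Mn x k c : (0 < k)%N -> 0 < x ?<= if c -> 0 < x *+ k ?<= if c.
Proof.
move=> + x0; case: k => // k _; elim: k => [|k IH] //.
by rewrite mulrS -[c]andbb; apply: lteif0D.
Qed.

Lemma mulrn_lteif0 x k c :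
  (0 < k)%N -> (0 < x *+ k ?<= if c) = (0 < x ?<= if c).
Proof.
move=> k0; apply/idP/idP => [|/lteif0Mn]; last exact.
apply: contraLR; rewrite -!lteifNE -!opp_lteif0 -mulNrn.
exact: lteif0Mn.
Qed.

Lemma mulrn_gt0 x k : (0 < k)%N -> (0 < x *+ k) = (0 < x).
Proof. exact: (@mulrn_lteif0 x k false). Qed.

Lemma mulrn_ge0 x k : 0 <= x -> 0 <= x *+ k.
Proof.
case: k => [|k]; first by rewrite mulr0n.
exact: (@lteif0Mn x k.+1 true).
Qed.

Lemma opp_gt0 x : (0 < - x) = (x < 0).
Proof. exact: (opp_lteif0 x false). Qed.

Lemma opp_ge0 x : (0 <= - x) = (x <= 0).
Proof. exact: (opp_lteif0 x true). Qed.

End OrderedGroup.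

Definition divisible (V : zmodType) : Prop :=
  forall (x : V) k, (0 < k)%N -> exists y, y *+ k = x.

Section Interval.
Variable V : orderedGroupType.

Lemma seq_least (T : eqType) (le : rel T) (s : seq T) :
  total le -> transitive le ->
  s = [::] \/ exists2 x, x \in s & forall y, y \in s -> le x y.
Proof.
move=> leT le_tr; elim: s => [|a s [->|[x xs xmin]]]; first by left.
  right; exists a => [|y]; rewrite inE ?eqxx // => /eqP->.
  by have := leT a a; rewrite orbb.
right; have /orP[ax|xa] := leT a x; [exists a => [|y]|exists x => [|y]].
- by rewrite inE eqxx.
- rewrite inE => /orP[/eqP->|/xmin]; last exact: le_tr.
  by have := leT a a; rewrite orbb.
- by rewrite inE xs orbT.
by rewrite inE => /orP[/eqP->|/xmin].
Qed.

(** The boolean attached to a bound says whether the bound may be attained.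
    When the largest lower bound equals the smallest upper bound this common
    value is the solution, the hypothesis making all bounds equal to it
    attainable; the positive [t] is there for the case when one of the lists
    is empty. *)
Lemma between (lo hi : seq (V * bool)) (t : V) :
  divisible V -> 0 < t ->
  {in lo & hi, forall l u, l.1 < u.1 ?<= if l.2 && u.2} ->
  exists x, {in lo, forall l, l.1 < x ?<= if l.2} /\
            {in hi, forall u, x < u.1 ?<= if u.2}.
Proof.
move=> divV t0 lohi.
have addt x : x < x + t by rewrite -{1}[x]addr0 ltD2.
have subt x : x - t < x by rewrite -{2}[x](subrK t) addt.
have [||lo0|[l ll lmax]] := @seq_least _ (fun x y : V * bool => y.1 <= x.1) lo.
- by move=> x y; exact: le_total.
- by move=> y x z yx zy; exact: le_trans yx.
- have [||hi0|[u uu umin]] := @seq_least _ (fun x y : V * bool => x.1 <= y.1) hi.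
  + by move=> x y; exact: le_total.
  + by move=> y x z; exact: le_trans.
  + by exists 0; rewrite lo0 hi0; split=> z.
  exists (u.1 - t); rewrite lo0; split=> [//|z /umin zu].
  exact/lteifS/(lt_le_trans (subt _)).
have [||hi0|[u uu umin]] := @seq_least _ (fun x y : V * bool => x.1 <= y.1) hi.
- by move=> x y; exact: le_total.
- by move=> y x z; exact: le_trans.
- exists (l.1 + t); rewrite hi0; split=> [z /lmax zl|//].
  exact/lteifS/(le_lt_trans zl).
have [lu|ul|lu] := ltgtP l.1 u.1.
- have [x xE] := divV (l.1 + u.1) 2 isT.
  have lx : l.1 < x.
    rewrite -[_ < _](sub_lteif0 _ _ false) -(@mulrn_lteif0 _ _ 2) // mulrnBl xE.
    by rewrite mulr2n opprD addrACA subrr add0r sub_lteif0.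
  have xu : x < u.1.
    rewrite -[_ < _](sub_lteif0 _ _ false) -(@mulrn_lteif0 _ _ 2) // mulrnBl xE.
    by rewrite mulr2n opprD addrACA subrr addr0 sub_lteif0.
  exists x; split=> z zin; apply: lteifS.
    exact: le_lt_trans (lmax _ zin) lx.
  exact: lt_le_trans xu (umin _ zin).
- by have := lteifW (lohi _ _ ll uu); rewrite leNgt ul.
exists l.1; split=> z zin.
  have := lohi _ _ zin uu; rewrite -lu.
  by apply: lteif_imply; apply/implyP => /andP[].
have := lohi _ _ ll zin.
by apply: lteif_imply; apply/implyP => /andP[].
Qed.

End Interval.

(** * Affine forms and Fourier-Motzkin elimination *)

Section Forms.
Variables (V : orderedGroupType) (n : nat).

(** The form c + sum_i w_i x_i, with integral coefficients w and a constant c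
    in V. *)
Definition affine_form : Type := ({ffun 'I_n -> int} * V)%type.
HB.instance Definition _ := GRing.Zmodule.on affine_form.

Definition coef (u : affine_form) (i : 'I_n) : int := u.1 i.

Lemma coefD u v i : coef (u + v) i = coef u i + coef v i.
Proof. by rewrite /coef ffunE. Qed.

Lemma coefMn u k i : coef (u *+ k) i = coef u i *+ k.
Proof. by elim: k => [|k IH]; rewrite ?mulrS ?coefD ?IH // /coef ffunE. Qed.

Definition eval_form (u : affine_form) (x : 'I_n -> V) : V :=
  u.2 + \sum_i x i *~ coef u i.

Lemma eval_formD u v x :
  eval_form (u + v) x = eval_form u x + eval_form v x.
Proof.
rewrite /eval_form addrACA -big_split /=; congr (_ + _).
by apply: eq_bigr => i _; rewrite coefD mulrzDr.
Qed.

Lemma eval_form0 x : eval_form 0 x = 0.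
Proof. by rewrite /eval_form big1 ?addr0 // => i _; rewrite /coef ffunE mulr0z. Qed.

Lemma eval_formN u x : eval_form (- u) x = - eval_form u x.
Proof.
by apply/eqP; rewrite -addr_eq0 addrC -eval_formD subrr eval_form0.
Qed.

Lemma eval_formMn u k x : eval_form (u *+ k) x = eval_form u x *+ k.
Proof.
by elim: k => [|k IH]; rewrite ?mulr0n ?eval_form0 // !mulrS eval_formD IH.
Qed.

Lemma eval_form_const a x : eval_form (0, a) x = a.
Proof. by rewrite /eval_form big1 ?addr0 // => i _; rewrite /coef ffunE mulr0z. Qed.

End Forms.

Section FourierMotzkin.
Variables (V : orderedGroupType) (n : nat).
Implicit Types (u v w : affine_form V n) (x : 'I_n -> V).
Implicit Types (cs : seq (affine_form V n * bool)).

(** A constraint [(u, c)] demands that [u] be positive, or only nonnegative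
    when [c] is true. *)
Definition sat x (z : affine_form V n * bool) : bool :=
  0 < eval_form z.1 x ?<= if z.2.

(** The constraints that follow from [cs] by adding: a sum is strict as soon
    as one of its terms is. *)
Inductive cone cs : affine_form V n -> bool -> Prop :=
| cone_gen u c of (u, c) \in cs : cone cs u c
| cone_add u c v e of cone cs u c & cone cs v e : cone cs (u + v) (c && e).

Lemma cone_muln cs u c k : (0 < k)%N -> cone cs u c -> cone cs (u *+ k) c.
Proof.
move=> + cu; case: k => // k _; elim: k => [|k IH] //.
by rewrite mulrS -[c]andbb; apply: cone_add.
Qed.

Lemma cone_trans cs cs' u c :
  (forall z, z \in cs' -> cone cs z.1 z.2) -> cone cs' u c -> cone cs u c.
Proof.
by move=> sub; elim=> [v e /sub//|v e w g _ cv _ cw]; apply: cone_add.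
Qed.

Section Step.
Variables (i : 'I_n) (cs : seq (affine_form V n * bool)).

(** The multiples are those for which the [i]-th coefficients cancel. *)
Definition resolvent (y z : affine_form V n * bool) : affine_form V n * bool :=
  (y.1 *+ `|coef z.1 i|%N + z.1 *+ `|coef y.1 i|%N, y.2 && z.2).

Definition eliminate : seq (affine_form V n * bool) :=
  [seq z <- cs | coef z.1 i == 0] ++
  [seq resolvent y z | y <- [seq y <- cs | 0 < coef y.1 i],
                       z <- [seq z <- cs | coef z.1 i < 0]].

Lemma eliminateP z : z \in eliminate ->
  (z \in cs /\ coef z.1 i = 0) \/
  exists y1 y2, [/\ y1 \in cs, y2 \in cs, 0 < coef y1.1 i, coef y2.1 i < 0
                  & z = resolvent y1 y2].
Proof.
rewrite mem_cat mem_filter => /orP[/andP[/eqP]|]; first by left.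
case/allpairsP => -[y1 y2] /= [].
rewrite !mem_filter => /andP[y1i y1cs] /andP[y2i y2cs] zE.
by right; exists y1, y2.
Qed.

Lemma eliminate_cone z : z \in eliminate -> cone cs z.1 z.2.
Proof.
case/eliminateP => [[zcs _]|[y1 [y2 [y1cs y2cs y1i y2i ->]]]].
  by case: z zcs => u c; apply: cone_gen.
have cs_cone z' : z' \in cs -> cone cs z'.1 z'.2.
  by case: z' => u c; apply: cone_gen.
apply: cone_add; (apply: cone_muln; last exact: cs_cone); rewrite absz_gt0.
  exact: ltr0_neq0.
by rewrite gt_eqF.
Qed.

Lemma eliminate_coef z j :
  j = i \/ (forall y, y \in cs -> coef y.1 j = 0) ->
  z \in eliminate -> coef z.1 j = 0.
Proof.
move=> jP; case/eliminateP => [[zcs zi]|[y1 [y2 [y1cs y2cs y1i y2i ->]]]].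
  by case: jP => [->//|/(_ z zcs)].
rewrite /= coefD !coefMn; case: jP => [->|j0]; last by rewrite !j0 ?mul0rn.
rewrite -[_ *+ `|coef y2.1 i|]mulr_natr -[_ *+ `|coef y1.1 i|]mulr_natr !natz.
rewrite (gtz0_abs y1i) (ltz0_abs y2i).
by rewrite mulrN mulrC addNr.
Qed.

Definition update x (a : V) : 'I_n -> V := fun j => if j == i then a else x j.

Lemma eval_form_update u x a :
  eval_form u (update x a) = eval_form u (update x 0) + a *~ coef u i.
Proof.
rewrite /eval_form (bigD1 i) //= [in RHS](bigD1 i) //= /update eqxx.
rewrite mul0rz add0r -[RHS]addrA [in RHS](addrC _ (a *~ _)).
congr (_ + (_ + _)).
by apply: eq_bigr => j /negPf->.
Qed.

Lemma update_id u x a : coef u i = 0 -> eval_form u (update x a) = eval_form u x.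
Proof.
move=> ui; congr (_ + _); apply: eq_bigr => j _; rewrite /update.
by case: eqP => [->|//]; rewrite ui !mulr0z.
Qed.

(** Solving each constraint for the [i]-th variable turns it into a lower or
    an upper bound, and the resolvents say that these bounds are
    compatible. *)
Lemma eliminate_sat x (t : V) :
  divisible V -> 0 < t -> all (sat x) eliminate ->
  exists y, all (sat y) cs.
Proof.
move=> divV t0 /allP satx.
have [quo quoK] : exists quo : V -> int -> V,
    forall a k, k != 0 -> quo a k *~ k = a.
  have /choice[q qK] : forall z : V * int, exists y, z.2 != 0 -> y *~ z.2 = z.1.
    move=> [a [k|k]] /=.
      have [->|k0] := eqVneq (Posz k) 0; first by exists 0.
      have [|y <-] := divV a k; first by case: (k) k0.
      by exists y.
    have [//|y yE] := divV a k.+1.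
    by exists (- y) => _; rewrite NegzE mulrNz mulNrz opprK.
  by exists (fun a k => q (a, k)) => a k; apply: (qK (a, k)).
pose bound (z : affine_form V n * bool) : V * bool :=
  (- quo (eval_form z.1 (update x 0)) (coef z.1 i), z.2).
have boundE a z : coef z.1 i != 0 ->
    eval_form z.1 (update x a) = (a - (bound z).1) *~ coef z.1 i.
  by move=> zi; rewrite eval_form_update /= opprK mulrzDl quoK // addrC.
pose lo := [seq bound z | z <- cs & 0 < coef z.1 i].
pose hi := [seq bound z | z <- cs & coef z.1 i < 0].
have bnd_lo a z : 0 < coef z.1 i ->
    sat (update x a) z = ((bound z).1 < a ?<= if z.2).
  move=> zi; rewrite /sat boundE ?(gt_eqF zi) // -{1}[coef z.1 i]gtz0_abs //.
  by rewrite mulrn_lteif0 ?absz_gt0 ?(gt_eqF zi) // sub_lteif0.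
have bnd_hi a z : coef z.1 i < 0 ->
    sat (update x a) z = (a < (bound z).1 ?<= if z.2).
  move=> zi; rewrite /sat boundE ?(lt_eqF zi) //.
  have {1}-> : coef z.1 i = - Posz `|coef z.1 i| by rewrite (ltz0_abs zi) opprK.
  rewrite mulrNz -mulNrz opprB.
  by rewrite mulrn_lteif0 ?absz_gt0 ?(lt_eqF zi) // sub_lteif0.
have [|a [alo ahi]] := between (lo := lo) (hi := hi) divV t0.
  move=> _ _ /mapP[y1 y1in ->] /mapP[y2 y2in ->].
  have := satx (resolvent y1 y2).
  rewrite mem_cat; move: (y1in) (y2in); rewrite !mem_filter.
  move=> /andP[y1i y1cs] /andP[y2i y2cs].
  rewrite (allpairs_f _ y1in y2in) orbT => /(_ isT).
  have ri : coef (resolvent y1 y2).1 i = 0.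
    apply: eliminate_coef; first by left.
    by rewrite mem_cat (allpairs_f _ y1in y2in) orbT.
  rewrite /sat -(@update_id _ x 0 ri) eval_formD !eval_formMn.
  rewrite !boundE ?(gt_eqF y1i) ?(lt_eqF y2i) // !sub0r.
  set b1 := (bound y1).1; set b2 := (bound y2).1.
  have -> : - b1 *~ coef y1.1 i = - b1 *+ `|coef y1.1 i|.
    by rewrite -{1}(gtz0_abs y1i).
  have -> : - b2 *~ coef y2.1 i = b2 *+ `|coef y2.1 i|.
    have c2E : coef y2.1 i = - Posz `|coef y2.1 i| by rewrite (ltz0_abs y2i) opprK.
    by rewrite {1}c2E mulrNz mulNrz opprK.
  rewrite -!mulrnA [in X in _ + X]mulnC -mulrnDl addrC.
  by rewrite mulrn_lteif0 ?sub_lteif0 // muln_gt0 !absz_gt0 gt_eqF ?lt_eqF.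
exists (update x a); apply/allP => z zcs.
have [zi|zi|zi] := Order.TotalTheory.ltgtP (coef z.1 i) 0.
- by rewrite bnd_hi // -[z.2]/((bound z).2) ahi // map_f // mem_filter zi.
- by rewrite bnd_lo // -[z.2]/((bound z).2) alo // map_f // mem_filter zi.
rewrite /sat update_id //; apply: satx.
by rewrite mem_cat mem_filter zi eqxx zcs.
Qed.

End Step.

(** An inconsistent system entails an absurd constraint between constants. *)
Theorem fourier_motzkin cs (t : V) :
  divisible V -> 0 < t ->
  (exists x, all (sat x) cs) \/
  (exists a c, cone cs (0, a) c /\ ~~ (0 < a ?<= if c)).
Proof.
move=> divV t0.
have: forall z j, j \notin enum 'I_n -> z \in cs -> coef z.1 j = 0.
  by move=> z j; rewrite mem_enum.
elim: (enum 'I_n) cs => [|i s IH] cs cs0.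
  have [cst|/allPn[[u c] ucs]] := boolP (all (sat (fun=> 0)) cs).
    by left; exists (fun=> 0).
  rewrite /sat /= => uF; right; exists u.2, c.
  have uE : u = (0, u.2).
    case: u ucs uF => [u a] ucs _; congr pair; apply/ffunP => j.
    by rewrite ffunE; apply: cs0 ucs.
  by rewrite -uE; split; [apply: cone_gen | rewrite uE eval_form_const in uF].
have [z j js|[x satx]|[a [c [ac aF]]]] := IH (eliminate i cs).
- apply: eliminate_coef; have [->|ji] := eqVneq j i; [by left|right=> y].
  by apply: cs0; rewrite inE negb_or ji.
- by left; exact: eliminate_sat divV t0 satx.
right; exists a, c; split=> //.
by apply: cone_trans ac; exact: eliminate_cone.
Qed.

End FourierMotzkin.

Section Consequences.
Variables (V : orderedGroupType) (n : nat).
Hypothesis divV : divisible V.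
Implicit Types (L M N u v : affine_form V n) (x y : 'I_n -> V).
Implicit Types (s : seq (affine_form V n)).

Definition positive_on s x : bool := all (fun L => 0 < eval_form L x) s.

Lemma positive_onP s x :
  reflect (forall L, L \in s -> 0 < eval_form L x) (positive_on s x).
Proof. exact: allP. Qed.

Lemma infeasible_cone (cs : seq (affine_form V n * bool)) (t : V) :
  0 < t -> (forall x, ~ all (sat x) cs) ->
  exists a c, cone cs (0, a) c /\ ~~ (0 < a ?<= if c).
Proof.
by move=> t0 inf; case: (fourier_motzkin cs divV t0) => // -[x /inf].
Qed.

(** A quantitative Farkas lemma: an affine form [N] that is positive on the
    polyhedron of [s] is bounded below everywhere in terms of the largest
    violation [t] of the constraints [s].  The system demanding [s > 0] and
    [N <= 0] is inconsistent, and in the certificate of this the form [- N]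
    must occur, because [s > 0] is consistent. *)
Lemma positive_bound s N x0 :
  positive_on s x0 -> (forall x, positive_on s x -> 0 < eval_form N x) ->
  exists k, forall x t, 0 <= t -> (forall L, L \in s -> - t <= eval_form L x) ->
    - (t *+ k) <= eval_form N x.
Proof.
move=> x0s Npos.
pose cs := (- N, true) :: [seq (L, false) | L <- s].
have [|a [c [ac aF]]] := infeasible_cone (cs := cs) (Npos _ x0s).
  move=> x /= /andP[/=]; rewrite /sat /= eval_formN opp_ge0 all_map => Nx.
  by move=> /Npos; rewrite ltNge Nx.
have [k [e [bnd pos]]] : exists k e, 
    (forall x t, 0 <= t -> (forall L, L \in s -> - t <= eval_form L x) ->
      - (t *+ k) <= eval_form ((0, a) + N *+ e) x) /\
    (forall x, positive_on s x -> 0 < eval_form ((0, a) + N *+ e) x ?<= if c).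
  (* e counts the occurrences of - N in the certificate, k those of s *)
  elim: ac => {a c aF} [u c|u c v e _ [k1 [e1 [b1 p1]]] _ [k2 [e2 [b2 p2]]]].
    rewrite inE => /orP[/eqP[-> ->]|/mapP[L Ls [-> ->]]].
      exists 0%N, 1%N; rewrite addNr.
      by split=> x *; rewrite eval_form0 ?lteifxx ?mulr0n ?oppr0.
    exists 1%N, 0%N; rewrite mulr0n addr0; split=> [x t t0 /(_ L Ls)//|x].
    by move/positive_onP/(_ L Ls).
  exists (k1 + k2)%N, (e1 + e2)%N; split=> x.
    move=> t t0 tL; rewrite !mulrnDr opprD addrACA eval_formD.
    apply: le_trans (_ : eval_form (u + N *+ e1) x - t *+ k2 <= _); last first.
      by rewrite leD2 b2.
    by rewrite addrC [leRHS]addrC leD2 b1.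
  move=> xs; rewrite mulrnDr addrACA eval_formD.
  by apply: lteif0D; [apply: p1|apply: p2].
case: e => [|e] in bnd pos *.
  have := pos _ x0s; rewrite mulr0n addr0 eval_form_const.
  by rewrite (negPf aF).
exists k => x t t0 tL; have := bnd x t t0 tL.
rewrite eval_formD eval_form_const eval_formMn.
have a0 : a <= 0.
  move: aF; rewrite -lteifNE; exact: lteifW.
move=> kx; have {}kx : - (t *+ k) <= eval_form N x *+ e.+1.
  by apply: le_trans kx _; rewrite leDr.
have [Nx|Nx] := leP 0 (eval_form N x).
  by apply: le_trans Nx; rewrite -opp_ge0 opprK mulrn_ge0.
apply: le_trans kx _; rewrite mulrS leDl.
by rewrite -opp_ge0 -mulNrn mulrn_ge0 // opp_ge0 ltW.
Qed.

(** An intermediate value theorem.  No continuity is involved: the certificate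
    that [s > 0] and [M = 0] are inconsistent bounds [e * M] from below by a
    positive quantity, for an integer [e] which is positive because [M] is
    positive at [x0]. *)
Lemma nonvanishing_positive s M x0 :
  positive_on s x0 -> 0 < eval_form M x0 ->
  (forall x, positive_on s x -> eval_form M x <> 0) ->
  forall x, positive_on s x -> 0 < eval_form M x.
Proof.
move=> x0s Mx0 Mneq0.
pose cs := [:: (M, true), (- M, true) & [seq (L, false) | L <- s]].
have [|a [c [ac aF]]] := infeasible_cone (cs := cs) Mx0.
  move=> x /= /and3P[/=]; rewrite /sat /= eval_formN opp_ge0 all_map.
  by move=> Mx Mx' /Mneq0; apply; apply/le_anti; rewrite Mx Mx'.
have [e pos] : exists e : int, forall x, positive_on s x ->
    0 < a + eval_form M x *~ e ?<= if c.
  suff [e pos] : exists e : int, forall x, positive_on s x ->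
      0 < eval_form (0, a) x + eval_form M x *~ e ?<= if c.
    by exists e => x /pos; rewrite eval_form_const.
  elim: ac => {a c aF} [u c|u c v f _ [e1 p1] _ [e2 p2]].
    rewrite !inE => /or3P[/eqP[-> ->]|/eqP[-> ->]|/mapP[L Ls [-> ->]]].
    - by exists (-1) => x _; rewrite mulrNz subrr lteifxx.
    - by exists 1 => x _; rewrite eval_formN addNr lteifxx.
    - by exists 0 => x /positive_onP/(_ L Ls); rewrite mulr0z addr0.
  exists (e1 + e2) => x xs; rewrite mulrzDr eval_formD addrACA.
  by apply: lteif0D; [apply: p1|apply: p2].
have Mpos x : positive_on s x -> 0 < eval_form M x *~ e.
  move=> /pos; move: aF; rewrite -lteifNE.
  case: c {ac pos} => /= a0 ae.
    by apply: le_lt_trans ae _; rewrite ltDr.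
  by apply: lt_le_trans ae _; rewrite leDr.
case: e {pos} Mpos => k Mpos.
  have k0 : (0 < k)%N.
    by case: k Mpos => // /(_ x0 x0s); rewrite mulr0z ltxx.
  by move=> x /Mpos; rewrite mulrn_gt0.
have := Mpos _ x0s; rewrite NegzE mulrNz opp_gt0 ltNge.
by rewrite mulrn_ge0 // ltW.
Qed.

(** The hypothesis says that the minimum of the forms [ms] never vanishes on
    the polyhedron.  By induction, the other forms are positive wherever the
    first one [M] is; by [positive_bound] they are then still nonnegative
    where [M] vanishes, which would make the minimum zero there.  So [M] does
    not vanish, and it keeps its sign. *)
Lemma no_tie_positive s (ms : seq (affine_form V n)) x0 :
  positive_on s x0 -> positive_on ms x0 ->
  (forall x M, positive_on s x -> M \in ms -> eval_form M x = 0 ->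
     exists2 M', M' \in ms & eval_form M' x < 0) ->
  forall x, positive_on s x -> positive_on ms x.
Proof.
elim: ms s => [//|M ms IH] s x0s /andP[Mx0 ms0] notie.
have {}IH x : positive_on (M :: s) x -> positive_on ms x.
  apply: IH => [||{}x M' /andP[/= Mx xs] M'ms M'x];
    rewrite /positive_on //= ?Mx0 //.
  have [|M'' + M''x] := notie x M' xs _ M'x; first by rewrite inE M'ms orbT.
  rewrite inE => /orP[/eqP M''E|M''ms]; last by exists M''.
  by move: M''x; rewrite M''E ltNge ltW.
have Mpos : forall x, positive_on s x -> 0 < eval_form M x.
  apply: (nonvanishing_positive x0s Mx0) => x xs Mx.
  have [|M' + M'x] := notie x M xs _ Mx; first by rewrite inE eqxx.
  rewrite inE => /orP[/eqP M'E|M'ms]; first by move: M'x; rewrite M'E Mx ltxx.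
  have [||k /(_ x 0 (lexx _))] := @positive_bound (M :: s) M' x0.
  - by rewrite /positive_on /= Mx0.
  - by move=> y /IH/positive_onP/(_ _ M'ms).
  rewrite mul0rn oppr0 leNgt M'x => bnd.
  suff: false by []; apply: bnd => L; rewrite inE => /orP[/eqP->|Ls].
    by rewrite Mx.
  by apply/ltW/(positive_onP _ _ xs).
move=> x xs; apply/andP; split; first exact: Mpos.
by apply: IH; rewrite /positive_on /= Mpos.
Qed.

End Consequences.

(** * The order by nu-values *)

Section NuOrder.
Variable R : supertropicalType.
Implicit Types (a b c g : R).

Lemma nu_ghost_id g : ghost g -> nu g = g.
Proof.
move=> gg; rewrite -{2}(nu1_ghost g gg) -addrr_nu -{1 2}(nu1_ghost g gg).
by rewrite -mulrDl addrr_nu nu_idem.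
Qed.

Lemma ghostD a b : ghost a -> ghost b -> ghost (a + b).
Proof. by case: (@ghost_ideal R) => _ + _; apply. Qed.

Lemma ghost0 : ghost (0 : R).
Proof. by case: (@ghost_ideal R). Qed.

Lemma ghostMl a g : ghost g -> ghost (a * g).
Proof. by case: (@ghost_ideal R) => _ _; apply. Qed.

Lemma ghostMr a g : ghost g -> ghost (g * a).
Proof. by rewrite mulrC; apply: ghostMl. Qed.

Lemma ghost_sum I (s : seq I) (P : pred I) (u : I -> R) :
  (forall i, P i -> ghost (u i)) -> ghost (\sum_(i <- s | P i) u i).
Proof. by move=> gu; apply: big_ind => //; [exact: ghost0|exact: ghostD]. Qed.

Lemma ghostX g k : (0 < k)%N -> ghost g -> ghost (g ^+ k).
Proof. by case: k => // k _ gg; rewrite exprS; apply: ghostMr. Qed.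

Lemma tangibleMl a b : tangible (a * b) -> tangible a.
Proof. by move=> tab ga; apply: tab; apply: ghostMr. Qed.

Lemma tangible_neq0 a : tangible a -> a <> 0.
Proof. by move=> ta a0; apply: ta; rewrite a0; exact: ghost0. Qed.

Lemma nu_eq0 a : nu a = 0 -> a = 0.
Proof. by move=> a0; rewrite -[a]addr0 addr_eq_nu ?a0 ?nu0. Qed.

Lemma ge_nu_refl a : ge_nu a a.
Proof. by rewrite /ge_nu addrr_nu nu_idem. Qed.

Lemma ge_nu_eq a b : nu a = nu b -> ge_nu a b.
Proof. by rewrite /ge_nu => ->; exact: ge_nu_refl. Qed.

Lemma ge_nu_total a b : ge_nu a b \/ ge_nu b a.
Proof.
have [/ge_nu_eq|ab] := pselect (nu a = nu b); first by left.
rewrite /ge_nu [nu b + _]addrC.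
by apply: addr_bipotent; rewrite !nu_idem.
Qed.

Lemma ge_nu_anti a b : ge_nu a b -> ge_nu b a -> nu a = nu b.
Proof. by rewrite /ge_nu addrC => -> ->. Qed.

Lemma ge_nu_trans b a c : ge_nu a b -> ge_nu b c -> ge_nu a c.
Proof. by rewrite /ge_nu => <- bc; rewrite -addrA bc. Qed.

Lemma ge_nu0 a : ge_nu a 0.
Proof. by rewrite /ge_nu nu0 addr0. Qed.

Lemma ge_nu_0eq a : ge_nu 0 a -> a = 0.
Proof. by rewrite /ge_nu nu0 add0r; exact: nu_eq0. Qed.

Lemma gt_nuN a b : gt_nu a b <-> ~ ge_nu b a.
Proof.
split=> [[ab nab] ba|ba]; first by apply: nab; exact: ge_nu_anti.
case: (ge_nu_total a b) => // ab; split=> // nab.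
by apply: ba; apply: ge_nu_eq.
Qed.

Lemma ge_nuN a b : ge_nu a b <-> ~ gt_nu b a.
Proof. by rewrite gt_nuN notK. Qed.

Lemma gt_nuW a b : gt_nu a b -> ge_nu a b. Proof. by case. Qed.

Lemma gt_ge_nu_trans b a c : gt_nu a b -> ge_nu b c -> gt_nu a c.
Proof. by rewrite !gt_nuN => ab bc ca; apply: ab; exact: ge_nu_trans ca. Qed.

Lemma ge_gt_nu_trans b a c : ge_nu a b -> gt_nu b c -> gt_nu a c.
Proof. by rewrite !gt_nuN => ab bc ca; apply: bc; exact: ge_nu_trans ab. Qed.

Lemma gt_nu0 a : gt_nu a 0 <-> a <> 0.
Proof.
rewrite gt_nuN; split=> [na a0|a0 /ge_nu_0eq//].
by apply: na; rewrite a0; exact: ge_nu_refl.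
Qed.

Lemma gt_nu_neq0 a b : gt_nu a b -> a <> 0.
Proof. by move=> /gt_ge_nu_trans/(_ (ge_nu0 b))/gt_nu0. Qed.

Lemma ge_nu_congr a a' b b' : nu a = nu a' -> nu b = nu b' ->
  ge_nu a b -> ge_nu a' b'.
Proof. by rewrite /ge_nu => -> ->. Qed.

Lemma gt_nu_congr a a' b b' : nu a = nu a' -> nu b = nu b' ->
  gt_nu a b -> gt_nu a' b'.
Proof. by rewrite /gt_nu /ge_nu => -> ->. Qed.

Lemma addr_gt_nu a b : gt_nu a b -> a + b = a.
Proof.
move=> [ab nab]; case: (addr_bipotent _ _ nab) => // abE.
by case: nab; rewrite -ab -nuD abE.
Qed.

Lemma addl_gt_nu a b : gt_nu b a -> a + b = b.
Proof. by rewrite addrC; exact: addr_gt_nu. Qed.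

Lemma addr_ghost a b : ghost a -> ge_nu a b -> a + b = a.
Proof.
move=> ga ab; have [nab|nab] := pselect (nu a = nu b).
  by rewrite addr_eq_nu // nu_ghost_id.
by rewrite addr_gt_nu.
Qed.

Lemma ge_nuDl a b : ge_nu (a + b) a.
Proof. by rewrite /ge_nu nuD addrAC addrr_nu nu_idem. Qed.

Lemma ge_nuD a b c : ge_nu a b -> ge_nu a c -> ge_nu a (b + c).
Proof. by rewrite /ge_nu nuD addrA => -> ->. Qed.

Lemma nuD_max a b : nu (a + b) = nu a \/ nu (a + b) = nu b.
Proof.
case: (ge_nu_total a b) => [|]; rewrite /ge_nu -nuD => ab; first by left.
by right; rewrite addrC.
Qed.

Lemma gt_nuD a b c : gt_nu a b -> gt_nu a c -> gt_nu a (b + c).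
Proof.
by move=> ab ac; case: (nuD_max b c) => /esym bc;
  [exact: gt_nu_congr ab|exact: gt_nu_congr ac].
Qed.

Lemma ge_nuM a b c : ge_nu a b -> ge_nu (c * a) (c * b).
Proof. by rewrite /ge_nu !nuM -mulrDr => ->. Qed.

Lemma ge_nuM2 a b c d : ge_nu a b -> ge_nu c d -> ge_nu (a * c) (b * d).
Proof.
move=> ab cd; apply: ge_nu_trans (ge_nuM a cd) _.
by rewrite ![_ * d]mulrC; exact: ge_nuM.
Qed.

Lemma ge_nuX a b k : ge_nu a b -> ge_nu (a ^+ k) (b ^+ k).
Proof.
move=> ab; elim: k => [|k IH]; first exact: ge_nu_refl.
by rewrite !exprS; exact: ge_nuM2.
Qed.

Section Sums.
Variables (I : eqType) (s : seq I) (P : pred I) (u : I -> R).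

Lemma ge_nu_sum i : i \in s -> P i -> ge_nu (\sum_(j <- s | P j) u j) (u i).
Proof.
by move=> si Pi; rewrite (big_rem i) //= Pi; exact: ge_nuDl.
Qed.

Lemma sum_ge_nu a : (forall i, i \in s -> P i -> ge_nu a (u i)) ->
  ge_nu a (\sum_(j <- s | P j) u j).
Proof.
move=> au; rewrite big_seq_cond; apply: big_ind => [||i /andP[]].
- exact: ge_nu0.
- by move=> x y; exact: ge_nuD.
- exact: au.
Qed.

Lemma sum_gt_nu a : a <> 0 -> (forall i, i \in s -> P i -> gt_nu a (u i)) ->
  gt_nu a (\sum_(j <- s | P j) u j).
Proof.
move=> a0 au; rewrite big_seq_cond; apply: big_ind => [||i /andP[]].
- exact/gt_nu0.
- by move=> x y; exact: gt_nuD.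
- exact: au.
Qed.

End Sums.

Lemma sum_nu_attained (I : eqType) (s : seq I) (u : I -> R) :
  \sum_(j <- s) u j <> 0 ->
  exists2 i, i \in s & nu (u i) = nu (\sum_(j <- s) u j).
Proof.
elim: s => [|i s IH]; first by rewrite big_nil.
rewrite big_cons; have [s0|/IH[j js jE] _] := pselect (\sum_(j <- s) u j = 0).
  by rewrite s0 addr0 => _; exists i; rewrite // inE eqxx.
case: (nuD_max (u i) (\sum_(j <- s) u j)) => ->.
  by exists i; rewrite // inE eqxx.
by exists j; rewrite // inE js orbT.
Qed.

(** Two terms tying for the largest nu-value make the sum a ghost. *)
Lemma tangible_sum (I : eqType) (s : seq I) (u : I -> R) :
  uniq s -> tangible (\sum_(j <- s) u j) ->
  exists2 i, i \in s & gt_nu (u i) (\sum_(j <- s | j != i) u j).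
Proof.
elim: s => [|i s IH] /=; first by rewrite big_nil => _ t0; case: t0; exact: ghost0.
move=> /andP[iNs us]; rewrite big_cons => tu.
have rest j : j \notin s -> \sum_(k <- s | k != j) u k = \sum_(k <- s) u k.
  move=> js; rewrite big_seq_cond [RHS]big_seq; apply: eq_bigl => k.
  by case: eqP => [->|]; rewrite ?(negPf js) ?andbT.
case: (pselect (nu (u i) = nu (\sum_(j <- s) u j))) => [nE|nE].
  by case: tu; rewrite addr_eq_nu //; exact: nu_ghost.
case: (ge_nu_total (u i) (\sum_(j <- s) u j)) => ge.
  by exists i; rewrite ?inE ?eqxx // big_cons eqxx rest.
have gt : gt_nu (\sum_(j <- s) u j) (u i) by split=> // /esym.
rewrite addl_gt_nu // in tu; have [j js jdom] := IH us tu.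
exists j; first by rewrite inE js orbT.
have ij : i != j by apply: contraNneq iNs => ->.
rewrite big_cons ij; apply: gt_nuD => //.
by move: gt; rewrite (bigD1_seq j) //= addr_gt_nu.
Qed.

End NuOrder.

Section Semifield.
Variable F : supertropicalSemifieldType.
Implicit Types (a b c g t : F).

Lemma tangible_lift a :
  exists t, [/\ nu t = nu a, tangible0 t & a <> 0 -> tangible t].
Proof.
have [->|a0] := pselect (a = 0).
  by exists 0; split=> //; right.
have [t tt <-] : (nu @` (tangible : set F)) (nu a).
  by rewrite nu_tangible; split; [exact: nu_ghost|move=> /= /nu_eq0].
by exists t; split=> //; left.
Qed.

Lemma tangible_inv a : a <> 0 -> exists2 t, tangible t & nu (a * t) = nu 1.
Proof.
move=> a0; have [s [sa _ /(_ a0) ts]] := tangible_lift a.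
have [t tt st] := tangibleV s ts.
by exists t; rewrite // nuM -sa -nuM st.
Qed.

Lemma mul_neq0 a b : a <> 0 -> b <> 0 -> a * b <> 0.
Proof.
have [s [sa _ ts]] := tangible_lift a; have [t [tb _ tt]] := tangible_lift b.
move=> /ts {}ts /tt {}tt ab0; apply: (tangible_neq0 (tangibleM _ _ ts tt)).
by apply: nu_eq0; rewrite nuM sa tb -nuM ab0 nu0.
Qed.

Lemma one_neq0 : (1 : F) <> 0.
Proof. exact/tangible_neq0/tangible1. Qed.

Lemma exp_neq0 a k : a <> 0 -> a ^+ k <> 0.
Proof.
by move=> a0; elim: k => [|k IH]; [exact: one_neq0|rewrite exprS; exact: mul_neq0].
Qed.

Lemma tangibleX t k : tangible t -> tangible (t ^+ k).
Proof.
by move=> tt; elim: k => [|k IH]; [exact: tangible1|rewrite exprS; exact: tangibleM].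
Qed.

Lemma ge_nuM_cancel a b c : c <> 0 -> ge_nu (c * a) (c * b) -> ge_nu a b.
Proof.
move=> /tangible_inv[t _ ct1] /(ge_nuM t).
by apply: ge_nu_congr; rewrite mulrA [t * c]mulrC nuM ct1 -nuM mul1r.
Qed.

Lemma gt_nuM a b c : c <> 0 -> gt_nu a b -> gt_nu (c * a) (c * b).
Proof.
move=> c0; rewrite !gt_nuN => ab /ge_nuM_cancel.
by apply: contra_not ab => /(_ c0).
Qed.

Lemma gt_ge_nuM2 a b c d : d <> 0 -> gt_nu a b -> ge_nu c d ->
  gt_nu (a * c) (b * d).
Proof.
move=> d0 ab cd; apply: ge_gt_nu_trans (ge_nuM _ cd) _.
by rewrite ![_ * d]mulrC; exact: gt_nuM.
Qed.

Lemma gt_nuX a b k : (0 < k)%N -> gt_nu a b -> gt_nu (a ^+ k) (b ^+ k).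
Proof.
move=> + ab; have a0 := gt_nu_neq0 ab.
case: k => // k _; have [->|b0] := pselect (b = 0).
  by rewrite [0 ^+ _]exprS mul0r; apply/gt_nu0/exp_neq0.
rewrite !exprS; apply: gt_ge_nuM2 => //; first exact: exp_neq0.
exact/ge_nuX/gt_nuW.
Qed.

End Semifield.

(** * The group of values *)

Section ValueGroup.
Variable F : supertropicalSemifieldType.

Definition is_value : pred F := fun g => `[< ghost g /\ g <> 0 >].

Record value_group : Type := Value { value_val : F; _ : is_value value_val }.

HB.instance Definition _ := [isSub for value_val].
HB.instance Definition _ := [Choice of value_group by <:].

Implicit Types (x y z : value_group).

Lemma value_ghost x : ghost (val x).
Proof. by have /asboolP[] := valP x. Qed.

Lemma value_neq0 x : val x <> 0.
Proof. by have /asboolP[] := valP x. Qed.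

Lemma nu_value x : nu (val x) = val x.
Proof. exact/nu_ghost_id/value_ghost. Qed.

Lemma is_value_nu (a : F) : a <> 0 -> is_value (nu a).
Proof. by move=> a0; apply/asboolP; split; [exact: nu_ghost|move=> /nu_eq0]. Qed.

Lemma is_valueM x y : is_value (val x * val y).
Proof.
apply/asboolP; split; first exact/ghostMl/value_ghost.
by apply: mul_neq0; exact: value_neq0.
Qed.

Lemma value_inv_subproof x : exists y, val x * val y = nu 1.
Proof.
have [t /tangible_neq0 t0 xt] := tangible_inv (@value_neq0 x).
by exists (Value (is_value_nu t0)); rewrite /= -xt nuM nu_value.
Qed.

Definition value_add x y : value_group := Value (is_valueM x y).
Definition value_zero : value_group := Value (is_value_nu (@one_neq0 F)).
Definition value_opp x : value_group := projT1 (cid (value_inv_subproof x)).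

Fact value_addA : associative value_add.
Proof. by move=> x y z; apply: val_inj; rewrite /= mulrA. Qed.

Fact value_addC : commutative value_add.
Proof. by move=> x y; apply: val_inj; rewrite /= mulrC. Qed.

Fact value_add0 : left_id value_zero value_add.
Proof. by move=> x; apply: val_inj; rewrite /= nu1_ghost //; exact: value_ghost. Qed.

Fact value_addN : left_inverse value_zero value_opp value_add.
Proof.
by move=> x; apply: val_inj; rewrite /= mulrC /value_opp; case: cid.
Qed.

HB.instance Definition _ := GRing.isZmodule.Build value_group
  value_addA value_addC value_add0 value_addN.

Definition value_le x y : bool := val y + val x == val y.

Lemma value_leE x y : value_le x y <-> ge_nu (val y) (val x).
Proof. by rewrite /ge_nu !nu_value /value_le; split=> /eqP. Qed.

Fact value_le_refl : reflexive value_le.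
Proof. by move=> x; apply/value_leE; exact: ge_nu_refl. Qed.

Fact value_le_anti : antisymmetric value_le.
Proof.
move=> x y /andP[/value_leE xy /value_leE yx]; apply: val_inj.
by rewrite -nu_value -[RHS]nu_value; exact: ge_nu_anti.
Qed.

Fact value_le_trans : transitive value_le.
Proof.
move=> y x z /value_leE xy /value_leE yz; apply/value_leE.
exact: ge_nu_trans xy.
Qed.

HB.instance Definition _ := Order.Le_isPOrder.Build ring_display value_group
  value_le_refl value_le_anti value_le_trans.

Fact value_le_total x y : (x <= y) || (y <= x).
Proof.
apply/orP; rewrite -[x <= y]/(value_le x y) -[y <= x]/(value_le y x) !value_leE.
exact: ge_nu_total.
Qed.

Fact value_leD2l z x y : x <= y -> z + x <= z + y.
Proof. by move=> /value_leE xy; apply/value_leE; exact: ge_nuM. Qed.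

HB.instance Definition _ :=
  isOrderedGroup.Build value_group value_le_total value_leD2l.

(** The logarithm of [a], written additively; it is only meaningful for
    nonzero [a]. *)
Definition value (a : F) : value_group := insubd (0 : value_group) (nu a).

Lemma val_value (a : F) : a <> 0 -> val (value a) = nu a.
Proof. by move=> a0; rewrite insubdK //; exact: is_value_nu. Qed.

Lemma value_eq (a : F) x : a <> 0 -> nu a = val x -> value a = x.
Proof. by move=> a0 ax; apply: val_inj; rewrite val_value. Qed.

Lemma value_surj x : exists2 t : F, tangible t & value t = x.
Proof.
have [t [tx _ tt]] := tangible_lift (val x); exists t; first exact/tt/value_neq0.
by apply: value_eq; [exact/tangible_neq0/tt/value_neq0|rewrite tx nu_value].
Qed.

Lemma valueM (a b : F) : a <> 0 -> b <> 0 -> value (a * b) = value a + value b.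
Proof.
move=> a0 b0; apply: value_eq; first exact: mul_neq0.
by rewrite nuM /= !val_value.
Qed.

Lemma value1 : value 1 = 0.
Proof. by apply: value_eq => //; exact: one_neq0. Qed.

Lemma valueX (a : F) k : a <> 0 -> value (a ^+ k) = value a *+ k.
Proof.
move=> a0; elim: k => [|k IH]; first exact: value1.
by rewrite exprS valueM ?IH ?mulrS //; exact: exp_neq0.
Qed.

Lemma value_le_ge_nu (a b : F) : a <> 0 -> b <> 0 ->
  (value a <= value b) <-> ge_nu b a.
Proof.
move=> a0 b0; rewrite -[_ <= _]/(value_le _ _) value_leE /ge_nu.
by rewrite !val_value // !nu_idem.
Qed.

Lemma value_lt_gt_nu (a b : F) : a <> 0 -> b <> 0 ->
  (value a < value b) <-> gt_nu b a.
Proof.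
move=> a0 b0; rewrite gt_nuN -value_le_ge_nu // ltNge.
by split=> /negP.
Qed.

(** A root of [x] exists as a formal root, hence in [F]; there it is unique,
    [root1] being injective. *)
Lemma value_divisible : divisibly_closed F -> divisible value_group.
Proof.
move=> [inv root1K invK] x k k0.
pose r : formal_root F := (val x, exist _ k k0).
pose b := inv (\pi_({eq_quot (@Defs.eq_root F)})%qT r).
have bE : Defs.root1 b = \pi_({eq_quot (@Defs.eq_root F)})%qT r := invK _.
have bk : b ^+ k = val x.
  apply: (can_inj root1K).
  have /eqmodP/asboolP[j j0 /= jE] := bE.
  apply/eqmodP/asboolP; exists j => //=.
  by rewrite mul1n -exprM jE mul1n.
have b0 : b <> 0.
  move=> b0; apply: (@value_neq0 x); rewrite -bk b0.
  by rewrite expr0n -(prednK k0).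
exists (value b); rewrite -valueX // bk.
by apply: value_eq; [exact: value_neq0|rewrite nu_value].
Qed.

End ValueGroup.

(** * Monomials and dominance *)

Section Monomials.
Variables (F : supertropicalSemifieldType) (n : nat).
Implicit Types (c e : F) (m k : 'X_{1..n}) (a b : 'I_n -> F) (p r : Defs.polynomial F n).

Lemma mono_eval_neq0 c m a :
  mono_eval c m a <> 0 <-> c <> 0 /\ forall i, m i != 0%N -> a i <> 0.
Proof.
rewrite /mono_eval; split=> [nz|[c0 a0]].
  split=> [c0|i mi ai]; apply: nz; first by rewrite c0 mul0r.
  by rewrite (bigD1 i) //= ai expr0n (negPf mi) mul0r mulr0.
apply: mul_neq0 => //; apply: (big_ind (fun x => x <> 0)) => [||i _].
- exact: one_neq0.
- by move=> x y; exact: mul_neq0.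
have [->|mi] := eqVneq (m i) 0%N; first by rewrite expr0; exact: one_neq0.
exact/exp_neq0/a0.
Qed.

Lemma mono_evalM c m e k a :
  mono_eval c m a * mono_eval e k a = mono_eval (c * e) (m + k)%MM a.
Proof.
rewrite /mono_eval mulrACA -big_split /=; congr (_ * _).
by apply: eq_bigr => i _; rewrite mnmDE exprD.
Qed.

Lemma mono_evalX c m j a :
  mono_eval c m a ^+ j = mono_eval (c ^+ j) (m *+ j)%MM a.
Proof.
rewrite /mono_eval exprMn -prodrXl; congr (_ * _).
by apply: eq_bigr => i _; rewrite mulmnE exprM.
Qed.

Lemma mono_eval_nu c m a b :
  (forall i, nu (a i) = nu (b i)) -> nu (mono_eval c m a) = nu (mono_eval c m b).
Proof.
move=> ab; rewrite !nuM; congr (_ * _).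
apply: (big_ind2 (fun x y => nu x = nu y)) => // [x y z t xy zt|i _].
  by rewrite !nuM xy zt.
by elim: (m i) => [|j IH]; rewrite ?expr0 // !exprS !nuM IH ab.
Qed.

Lemma tangible_mono_eval c m a :
  tangible c -> (forall i, m i != 0%N -> tangible (a i)) ->
  tangible (mono_eval c m a).
Proof.
move=> tc ta; apply: tangibleM => //.
apply: (big_ind (fun x : F => tangible x)) => [||i _].
- exact: tangible1.
- exact: tangibleM.
have [->|mi] := eqVneq (m i) 0%N; first by rewrite expr0; exact: tangible1.
exact/tangibleX/ta.
Qed.

Definition dominates p m a : Prop :=
  gt_nu (mono_eval (p m) m a)
        (\sum_(k <- finsupp p | k != m) mono_eval (p k) k a).

Lemma dominatesP p m a : dominates p m a <->
  mono_eval (p m) m a <> 0 /\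
  forall k, k \in finsupp p -> k != m ->
    gt_nu (mono_eval (p m) m a) (mono_eval (p k) k a).
Proof.
split=> [dom|[nz gt]]; last exact: sum_gt_nu.
split=> [|k kp km]; first exact: gt_nu_neq0 dom.
apply: gt_ge_nu_trans dom _.
exact: (ge_nu_sum (fun k => mono_eval (p k) k a) kp km).
Qed.

Lemma poly_eval_ge p m a :
  m \in finsupp p -> ge_nu (poly_eval p a) (mono_eval (p m) m a).
Proof. by move=> mp; exact: (ge_nu_sum (fun k => mono_eval (p k) k a) mp). Qed.

Lemma poly_eval_neq0 p m a :
  m \in finsupp p -> mono_eval (p m) m a <> 0 -> poly_eval p a <> 0.
Proof. by move=> /poly_eval_ge + m0 p0 => /(_ a); rewrite p0 => /ge_nu_0eq. Qed.

Lemma dominates_uniq p m k a : m \in finsupp p -> k \in finsupp p ->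
  dominates p m a -> dominates p k a -> m = k.
Proof.
move=> mp kp /dominatesP[_ gtm] /dominatesP[_ gtk].
apply/eqP/negPn/negP => mk.
have /gt_nuN := gtk m mp mk; apply; apply/gt_nuW/gtm => //.
by rewrite eq_sym.
Qed.

Lemma dominates_congr p m a b : (forall i, nu (a i) = nu (b i)) ->
  dominates p m a -> dominates p m b.
Proof.
move=> ab /dominatesP[nz gt]; apply/dominatesP; split.
  move=> b0; apply: nz; apply: nu_eq0.
  by rewrite (mono_eval_nu _ _ ab) b0 nu0.
by move=> k kp km; apply: gt_nu_congr (gt k kp km); exact: mono_eval_nu.
Qed.

Lemma dominates_eval p m a : m \in finsupp p -> dominates p m a ->
  poly_eval p a = mono_eval (p m) m a.
Proof.
by move=> mp dom; rewrite /poly_eval (bigD1_seq m mp (fset_uniq _)) /= addr_gt_nu.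
Qed.

Lemma tangible_dominated p a : tangible (poly_eval p a) ->
  exists2 m, m \in finsupp p & dominates p m a /\ tangible (p m).
Proof.
move=> ta; have [|m mp dom] := tangible_sum _ ta; first exact: fset_uniq.
exists m => //; split=> //.
by move: ta; rewrite (dominates_eval mp dom); exact: tangibleMl.
Qed.

(** Dominance depends only on the nu-values of the coordinates, so each point
    may be replaced by one with coordinates in [tangible0]. *)
Lemma dominates_component (f : {polyfun F[n]}) p m a : m \in finsupp p ->
  poly_eval p = f -> tangible (p m) -> dominates p m a ->
  exists2 b, (forall i, nu (a i) = nu (b i)) & component f (p m) m b.
Proof.
move=> mp pf tm dom.
have /choice[b bP] := fun i => tangible_lift (a i).
exists b => [i|]; first by case: (bP i).
have domb : dominates p m b.
  by apply: dominates_congr dom => i; case: (bP i).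
split=> [i||]; first by case: (bP i).
  by rewrite -pf (dominates_eval mp domb).
apply: tangible_mono_eval => // i mi; have [_ _] := bP i; apply.
by have /dominatesP[/mono_eval_neq0[_ /(_ i mi)]] := dom.
Qed.

Definition restrict m a : 'I_n -> F := fun i => if m i == 0%N then 0 else a i.

Lemma restrict_neq0 m a i : restrict m a i <> 0 -> m i != 0%N.
Proof. by rewrite /restrict; case: eqP. Qed.

Lemma mono_eval_restrict c m k a :
  mono_eval c k (restrict m a) = mono_eval c k a \/
  mono_eval c k (restrict m a) = 0.
Proof.
have [kz|kz] := pselect (mono_eval c k (restrict m a) = 0); first by right.
left; move/mono_eval_neq0: kz => [_ kz]; congr (_ * _).
apply: eq_bigr => i _; have [->//|/kz] := eqVneq (k i) 0%N.
by rewrite /restrict; case: eqP.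
Qed.

Lemma dominates_restrict p m a : dominates p m a -> dominates p m (restrict m a).
Proof.
move=> /dominatesP[nz gt].
have mE : mono_eval (p m) m (restrict m a) = mono_eval (p m) m a.
  congr (_ * _); apply: eq_bigr => i _; rewrite /restrict.
  by case: eqP => // ->.
apply/dominatesP; rewrite mE; split=> // k kp km.
by case: (mono_eval_restrict (p k) m k a) => ->; [exact: gt|exact/gt_nu0].
Qed.

End Monomials.

(** * Perturbation of zero coordinates *)

Section Perturbation.
Variables (F : supertropicalSemifieldType) (n : nat) (tau : F).
Hypothesis tau_neq0 : tau <> 0.
Hypothesis tau_lt1 : gt_nu 1 tau.

Lemma small_scale (s : seq (F * F)) : (forall z, z \in s -> z.1 <> 0) ->
  exists t, [/\ t <> 0, ge_nu 1 t
              & forall z, z \in s -> gt_nu z.1 (t * z.2)].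
Proof.
elim: s => [|z s IH] s0.
  by exists 1; split=> //; [exact: one_neq0|exact: ge_nu_refl].
have [|t [t0 t1 ts]] := IH; first by move=> y ys; apply: s0; rewrite inE ys orbT.
have z0 : z.1 <> 0 by apply: s0; rewrite inE eqxx.
have [zt|zt] := pselect (gt_nu z.1 (t * z.2)).
  by exists t; split=> // y; rewrite inE => /orP[/eqP->//|/ts].
have z20 : z.2 <> 0.
  by move=> z20; apply: zt; rewrite z20 mulr0; exact/gt_nu0.
have [v /tangible_neq0 v0 zv] := tangible_inv z20.
have rz : gt_nu z.1 (tau * z.1 * v * z.2).
  apply: (@gt_nu_congr _ (z.1 * 1) _ (z.1 * tau)); last exact: gt_nuM.
    by rewrite mulr1.
  by rewrite -[in RHS]mulrA [v * _]mulrC [in RHS]nuM zv -nuM mulr1 mulrC.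
have rt : ge_nu t (tau * z.1 * v).
  apply: (ge_nuM_cancel z20); rewrite ![z.2 * _]mulrC.
  move/ge_nuN: zt => zt.
  exact: ge_nu_trans zt (gt_nuW rz).
exists (tau * z.1 * v); split.
- by apply: mul_neq0 => //; exact: mul_neq0.
- exact: ge_nu_trans rt.
move=> y; rewrite inE => /orP[/eqP->//|/ts yt].
by apply: gt_ge_nu_trans yt _; rewrite ![_ * y.2]mulrC; exact: ge_nuM.
Qed.

Definition fill (t : F) (a : 'I_n -> F) : 'I_n -> F :=
  fun i => if a i == 0 then t else a i.

Lemma fill_neq0 t a i : t <> 0 -> fill t a i <> 0.
Proof. by rewrite /fill; case: eqP. Qed.

Lemma mono_eval_fill c m t a : mono_eval c m a <> 0 ->
  mono_eval c m (fill t a) = mono_eval c m a.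
Proof.
move=> /mono_eval_neq0[_ a0]; congr (_ * _); apply: eq_bigr => i _.
have [->//|/a0] := eqVneq (m i) 0%N.
by rewrite /fill; case: eqP.
Qed.

(** The factor [t] comes from a vanishing coordinate that occurs in the
    monomial; the other ones contribute at most 1. *)
Lemma mono_eval_fill_small c m t a : ge_nu 1 t -> mono_eval c m a = 0 ->
  ge_nu (t * mono_eval c m (fill 1 a)) (mono_eval c m (fill t a)).
Proof.
move=> t1 ca0; have [->|c0] := pselect (c = 0).
  by rewrite /mono_eval !mul0r; exact: ge_nu0.
have [i mi ai] : exists2 i, m i != 0%N & a i = 0.
  apply: contrapT => noi; suff: mono_eval c m a <> 0 by [].
  apply/mono_eval_neq0; split=> // i mi ai.
  by apply: noi; exists i.
rewrite /mono_eval mulrCA; apply: ge_nuM.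
rewrite (bigD1 i) //= [in X in ge_nu _ X](bigD1 i) //= /fill ai eqxx expr1n mul1r.
apply: ge_nuM2.
  case: (m i) mi => // j _; rewrite exprS -[t in ge_nu t _]mulr1.
  by apply: ge_nuM; rewrite -[1](expr1n _ j); exact: ge_nuX.
apply: (big_ind2 (@ge_nu F)) => [|x y z u|j _]; first exact: ge_nu_refl.
  exact: ge_nuM2.
by apply: ge_nuX; case: eqP => // _; exact: ge_nu_refl.
Qed.

(** A monomial that is nonzero at [a] does not involve the zero coordinates of
    [a], so it keeps its value when these become nonzero, while a monomial
    that vanishes at [a] remains small. *)
Lemma perturbation (s : seq ((F * 'X_{1..n}) * (F * 'X_{1..n}))) a :
  (forall z, z \in s ->
     gt_nu (mono_eval z.1.1 z.1.2 a) (mono_eval z.2.1 z.2.2 a)) ->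
  exists b, (forall i, b i <> 0) /\
    forall z, z \in s ->
      gt_nu (mono_eval z.1.1 z.1.2 b) (mono_eval z.2.1 z.2.2 b).
Proof.
move=> sa.
pose s' := [seq (mono_eval z.1.1 z.1.2 a, mono_eval z.2.1 z.2.2 (fill 1 a))
           | z <- s].
have [|t [t0 t1 ts]] := @small_scale s'.
  by move=> _ /mapP[z zs ->] /=; exact: gt_nu_neq0 (sa z zs).
exists (fill t a); split=> [i|z zs]; first exact: fill_neq0.
rewrite mono_eval_fill; last exact: gt_nu_neq0 (sa z zs).
have [z0|z0] := pselect (mono_eval z.2.1 z.2.2 a = 0).
  apply: gt_ge_nu_trans (mono_eval_fill_small t1 z0).
  by apply: (ts (_, _)); apply/mapP; exists z.
by rewrite mono_eval_fill //; exact: sa.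
Qed.

(** The pair with the zero monomial says that the dominating monomial does not
    vanish. *)
Definition domination_pairs (p : Defs.polynomial F n) m :
    seq ((F * 'X_{1..n}) * (F * 'X_{1..n})) :=
  ((p m, m), (0, 0%MM)) ::
  [seq ((p m, m), (p k, k)) | k <- enum_fset (finsupp p) & k != m].

Lemma domination_pairsP p m a : dominates p m a <->
  forall z, z \in domination_pairs p m ->
    gt_nu (mono_eval z.1.1 z.1.2 a) (mono_eval z.2.1 z.2.2 a).
Proof.
have zE : mono_eval 0 0%MM a = 0 by rewrite /mono_eval mul0r.
rewrite dominatesP; split=> [[nz gt] z|gt].
  rewrite inE => /orP[/eqP->|/mapP[k + ->]] /=; first by rewrite zE; exact/gt_nu0.
  by rewrite mem_filter => /andP[km kp]; exact: gt.
split=> [|k kp km].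
  by move: (gt _ (mem_head _ _)); rewrite /= zE => /gt_nu0.
apply: (gt ((_, _), (_, _))); rewrite inE; apply/orP; right.
by apply/mapP; exists k => //; rewrite mem_filter km.
Qed.

Lemma perturb_dominates2 p m r k (a : 'I_n -> F) :
  dominates p m a -> dominates r k a ->
  exists b, [/\ forall i, b i <> 0, dominates p m b & dominates r k b].
Proof.
move=> /domination_pairsP pa /domination_pairsP ra.
have [z|b [b0 bs]] := @perturbation (domination_pairs p m ++ domination_pairs r k) a.
  by rewrite mem_cat => /orP[/pa|/ra].
exists b; split=> //; apply/domination_pairsP => z zs; apply: bs;
  by rewrite mem_cat zs ?orbT.
Qed.

Lemma ge_nu_everywhere (s : Defs.polynomial F n) c m :
  (forall a, (forall i, a i <> 0) -> ge_nu (poly_eval s a) (mono_eval c m a)) ->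
  forall a, ge_nu (poly_eval s a) (mono_eval c m a).
Proof.
move=> full a; apply/ge_nuN => gta.
have ca0 := gt_nu_neq0 gta.
pose ps := [seq ((c, m), (s k, k)) | k <- enum_fset (finsupp s)].
have [_ /mapP[k ks ->] /=|b [b0 bs]] := @perturbation ps a.
  apply: gt_ge_nu_trans gta _.
  exact: (ge_nu_sum (fun k => mono_eval (s k) k a) ks).
have /ge_nuN := full b b0; apply; apply: sum_gt_nu => [|k ks _].
  apply/mono_eval_neq0; split=> //.
  by move/mono_eval_neq0: ca0 => [].
by apply: (bs ((_, _), (_, _))); apply/mapP; exists k.
Qed.

End Perturbation.

(** * Logarithmic coordinates *)

Section Logarithm.
Variables (F : supertropicalSemifieldType) (n : nat).
Implicit Types (c e : F) (m k : 'X_{1..n}) (a : 'I_n -> F) (p : Defs.polynomial F n).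
Local Notation V := (value_group F).

Definition mono_form c m : affine_form V n := ([ffun i => Posz (m i)], value c).

Lemma value_mono c m a : c <> 0 -> (forall i, a i <> 0) ->
  value (mono_eval c m a) = eval_form (mono_form c m) (fun i => value (a i)).
Proof.
move=> c0 a0; rewrite /mono_eval /eval_form /=.
have prod_neq0 (s : seq 'I_n) : \prod_(i <- s) a i ^+ m i <> 0.
  apply: (big_ind (fun x => x <> 0)) => [|x y|i _]; first exact: one_neq0.
    exact: mul_neq0.
  exact: exp_neq0.
rewrite valueM //; congr (_ + _).
elim: (index_enum _) => [|i s IH]; first by rewrite !big_nil value1.
rewrite !big_cons valueM ?IH ?valueX //; last exact: exp_neq0.
by rewrite /coef ffunE.
Qed.

Definition differences p m : seq (affine_form V n) :=
  [seq mono_form (p m) m - mono_form (p k) k | k <- finsupp p & k != m].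

Lemma coef_neq0 p k : k \in finsupp p -> p k <> 0.
Proof. by rewrite mem_finsupp => /eqP. Qed.

Lemma mono_eval_full c m a :
  c <> 0 -> (forall i, a i <> 0) -> mono_eval c m a <> 0.
Proof. by move=> c0 a0; apply/mono_eval_neq0. Qed.

Lemma eval_difference c m e k a :
  c <> 0 -> e <> 0 -> (forall i, a i <> 0) ->
  eval_form (mono_form c m - mono_form e k) (fun i => value (a i)) =
    value (mono_eval c m a) - value (mono_eval e k a).
Proof. by move=> c0 e0 a0; rewrite eval_formD eval_formN !value_mono. Qed.

Lemma dominates_differences p m a : m \in finsupp p -> (forall i, a i <> 0) ->
  dominates p m a <-> positive_on (differences p m) (fun i => value (a i)).
Proof.
move=> mp a0; have pm0 := coef_neq0 mp; rewrite dominatesP.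
split=> [[_ gt]|/positive_onP pos].
  apply/positive_onP => _ /mapP[k + ->]; rewrite mem_filter => /andP[km kp].
  have pk0 := coef_neq0 kp; rewrite eval_difference // sub_gt0.
  apply/value_lt_gt_nu; try exact: mono_eval_full.
  exact: gt.
split=> [|k kp km]; first exact: mono_eval_full.
have pk0 := coef_neq0 kp.
apply/value_lt_gt_nu; try exact: mono_eval_full.
rewrite -sub_gt0 -eval_difference //; apply: pos.
by apply/mapP; exists k; rewrite // mem_filter km.
Qed.

Lemma lift_point (x : 'I_n -> V) :
  exists2 a, (forall i, a i <> 0) & (fun i => value (a i)) = x.
Proof.
have /choice[a aP] : forall i, exists t : F, t <> 0 /\ value t = x i.
  by move=> i; have [t /tangible_neq0 t0 tx] := value_surj (x i); exists t.
by exists a => [i|]; [case: (aP i)|apply/funext => i; case: (aP i)].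
Qed.

End Logarithm.

Section Dichotomy.
Variable F : supertropicalSemifieldType.

(** The group of values has arbitrarily small elements as soon as it has one
    below 1, and otherwise it is trivial: if a < b then a / b < 1. *)
Lemma nontrivial_or_flat :
  (exists2 t : F, t <> 0 & gt_nu 1 t) \/
  (forall a b : F, a <> 0 -> b <> 0 -> ge_nu a b).
Proof.
have [|triv] := pselect (exists2 t : F, t <> 0 & gt_nu 1 t); first by left.
right=> a b a0 b0; apply/ge_nuN => ba; apply: triv.
have [v /tangible_neq0 v0 bv] := tangible_inv b0.
exists (v * a); first exact: mul_neq0.
apply: (@gt_nu_congr _ (v * b) _ (v * a)) => //; last exact: gt_nuM.
by rewrite mulrC.
Qed.

Lemma uniform_bound (T : eqType) (s : seq T) (Q : T -> nat -> Prop) :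
  (forall x i j, (i <= j)%N -> Q x i -> Q x j) ->
  (forall x, x \in s -> exists i, Q x i) ->
  exists i, forall x, x \in s -> Q x i.
Proof.
move=> Qmono; elim: s => [|x s IH] sQ; first by exists 0%N.
have [|i iQ] := IH; first by move=> y ys; apply: sQ; rewrite inE ys orbT.
have [|j jQ] := sQ x; first by rewrite inE eqxx.
exists (maxn i j) => y; rewrite inE => /orP[/eqP->|/iQ].
  by apply: Qmono jQ; exact: leq_maxr.
by apply: Qmono; exact: leq_maxl.
Qed.

End Dichotomy.

(** * The multiplier of an essential monomial *)

Section Region.
Variables (F : supertropicalSemifieldType) (n : nat).
Variables (p r : Defs.polynomial F n) (m : 'X_{1..n}).
Hypothesis divF : divisibly_closed F.
Hypothesis mp : m \in finsupp p.
Hypothesis m_ess : exists a, dominates p m a.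
Hypothesis r_dom : forall a, dominates p m a ->
  exists2 k, k \in finsupp r & dominates r k a.

(** At points with nonzero coordinates this is [no_tie_positive], as a tie
    would contradict [r_dom]; the other points are reached by
    perturbation.  If all nonzero values are equal, the monomial dominating at
    the point with the smallest possible support, that of [m], is nonzero at
    every other point of the region, and therefore dominates there. *)
Lemma constant_dominator :
  exists2 k, k \in finsupp r & forall a, dominates p m a -> dominates r k a.
Proof.
have [a0 ma0] := m_ess.
have [[t t0 t1]|flat] := nontrivial_or_flat F.
  have [k [a1 [a10 ma1 ka1]]] :
      exists k, exists a1, [/\ forall i, a1 i <> 0, dominates p m a1 &
        k \in finsupp r /\ dominates r k a1].
    have [a1 [a10 ma1 _]] := perturb_dominates2 t0 t1 ma0 ma0.
    by have [k kr ka1] := r_dom ma1; exists k, a1.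
  case: ka1 => kr ka1.
  have full a : (forall i, a i <> 0) -> dominates p m a -> dominates r k a.
    move=> an0 /(dominates_differences mp an0) ma.
    apply/(dominates_differences kr an0).
    apply: (no_tie_positive (value_divisible divF)) ma.
    - by apply/(dominates_differences mp a10); exact: ma1.
    - by apply/(dominates_differences kr a10).
    move=> x M + /mapP[j + ->].
    have [b b0 <-] := lift_point x.
    move=> /(dominates_differences mp b0)/r_dom[l lr lb].
    rewrite mem_filter => /andP[jk jr] tie.
    have [lk|lk] := eqVneq l k.
      rewrite lk in lb; move/(dominates_differences kr b0)/positive_onP: lb.
      move=> /(_ (mono_form (r k) k - mono_form (r j) j)).
      rewrite tie ltxx => /(_ _)/negP[] //.
      by apply/mapP; exists j; rewrite // mem_filter jk.
    exists (mono_form (r k) k - mono_form (r l) l).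
      by apply/mapP; exists l; rewrite // mem_filter lk.
    rewrite -opp_gt0 -eval_formN opprB.
    move/(dominates_differences lr b0)/positive_onP: lb; apply.
    by apply/mapP; exists k; rewrite // mem_filter eq_sym lk.
  exists k => // a ma; have [l lr la] := r_dom ma.
  have [b [b0 mb lb]] := perturb_dominates2 t0 t1 ma la.
  by rewrite (dominates_uniq kr lr (full b b0 mb) lb).
have [k kr ka1] := r_dom (dominates_restrict ma0).
exists k => // a ma; have [l lr la] := r_dom ma.
have [<-//|lk] := eqVneq l k.
have /dominatesP[la0 /(_ k kr)] := la; rewrite eq_sym lk => /(_ isT)/gt_nuN[].
apply: flat => //; apply/mono_eval_neq0; split; first exact: coef_neq0.
move=> i ki; have /dominatesP[/mono_eval_neq0[_ am] _] := ma; apply: am.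
have /dominatesP[/mono_eval_neq0[_ ar] _] := ka1.
exact: restrict_neq0 (ar i ki).
Qed.

(** Coordinates outside the support of [m] may be replaced by zero without
    leaving the region. *)
Lemma dominator_support k : k \in finsupp r ->
  (forall a, dominates p m a -> dominates r k a) ->
  forall i, k i != 0%N -> m i != 0%N.
Proof.
move=> kr kdom i ki; have [a ma] := m_ess.
have /kdom/dominatesP[/mono_eval_neq0[_ kn0] _] := dominates_restrict ma.
exact: restrict_neq0 (kn0 i ki).
Qed.

(** With v = log p - log p_m, which measures by how much the point violates
    the inequalities defining the region, [positive_bound] gives
    log r_k - log r_l >= - j v. *)
Lemma full_point_bound k : k \in finsupp r ->
  (forall a, dominates p m a -> dominates r k a) ->
  exists j0, forall j a l, (j0 <= j)%N -> (forall i, a i <> 0) -> l \in finsupp r ->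
    ge_nu (poly_eval p a ^+ j * mono_eval (r k) k a)
          (mono_eval (p m) m a ^+ j * mono_eval (r l) l a).
Proof.
move=> kr kdom; have pm0 := coef_neq0 mp.
have [[t t0 t1]|flat] := nontrivial_or_flat F; last first.
  exists 0%N => j a l _ a0 lr; have pa0 : poly_eval p a <> 0.
    by apply: (poly_eval_neq0 mp); exact: mono_eval_full.
  have ra0 l' : l' \in finsupp r -> mono_eval (r l') l' a <> 0.
    by move=> l'r; apply: mono_eval_full => //; exact: coef_neq0.
  apply: flat; apply: mul_neq0; try exact: exp_neq0; try exact: ra0.
  exact/exp_neq0/mono_eval_full.
have [a1 a10 ma1] : exists2 a1, (forall i, a1 i <> 0) & dominates p m a1.
  have [a0 ma0] := m_ess.
  by have [a1 [a10 ma1 _]] := perturb_dominates2 t0 t1 ma0 ma0; exists a1.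
pose Q l j := forall (x : 'I_n -> value_group F) v, 0 <= v ->
  (forall L, L \in differences p m -> - v <= eval_form L x) ->
  - (v *+ j) <= eval_form (mono_form (r k) k - mono_form (r l) l) x.
have [||j0 j0Q] := @uniform_bound _ (enum_fset (finsupp r)) Q.
- move=> l i j ij lQ x v v0 /(lQ x v v0); apply: le_trans.
  rewrite -(subnKC ij) mulrnDr opprD leDl -opp_ge0 opprK.
  exact: mulrn_ge0.
- move=> l lr; have [->|lk] := eqVneq l k.
    exists 0%N => x v v0 _; rewrite mulr0n oppr0 subrr.
    by rewrite eval_form0.
  have [||j jP] := @positive_bound _ _ (value_divisible divF) (differences p m)
     (mono_form (r k) k - mono_form (r l) l) (fun i => value (a1 i)).
  + exact/dominates_differences.
  + move=> x; have [b b0 <-] := lift_point x.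
    move=> /(dominates_differences mp b0)/kdom/(dominates_differences kr b0).
    by move/positive_onP; apply; apply/mapP; exists l; rewrite // mem_filter lk.
  by exists j => x v v0 vL; exact: jP.
exists j0 => j a l j0j a0 lr.
have pa0 : poly_eval p a <> 0.
  by apply: (poly_eval_neq0 mp); exact: mono_eval_full.
have term0 (s : Defs.polynomial F n) i : i \in finsupp s -> mono_eval (s i) i a <> 0.
  by move=> iS; apply: mono_eval_full => //; exact: coef_neq0.
have ple i : i \in finsupp p ->
    value (mono_eval (p i) i a) <= value (poly_eval p a).
  move=> ip; apply/value_le_ge_nu => //; first exact: term0.
  exact: poly_eval_ge.
have valueXM (x y : F) : x <> 0 -> y <> 0 ->
    value (x ^+ j * y) = value x *+ j + value y.
  by move=> x0 y0; rewrite valueM ?valueX //; exact: exp_neq0.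
have XM_neq0 (x y : F) : x <> 0 -> y <> 0 -> x ^+ j * y <> 0.
  by move=> x0 y0; apply: mul_neq0 => //; exact: exp_neq0.
have m0 := term0 _ _ mp; have k0 := term0 _ _ kr; have l0 := term0 _ _ lr.
apply/value_le_ge_nu; try exact: XM_neq0.
rewrite !valueXM //.
pose v := value (poly_eval p a) - value (mono_eval (p m) m a).
have v0 : 0 <= v by rewrite sub_ge0; exact: ple.
have /(_ v v0) := j0Q l lr (fun i => value (a i)).
rewrite eval_difference //; try exact: coef_neq0.
set f := value (poly_eval p a) in v v0 ple *; set h := value (mono_eval (r l) l a).
set g := value (mono_eval (r k) k a); move=> bnd.
rewrite -sub_ge0 [_ + g]addrC [_ + h]addrC opprD addrACA -mulrnBl -/v.
rewrite -[v *+ j]opprK sub_ge0.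
apply: le_trans (bnd _) => [|_ /mapP[i + ->]].
  rewrite -(subnKC j0j) mulrnDr opprD leDl -opp_ge0 opprK; exact: mulrn_ge0.
rewrite mem_filter => /andP[im ip].
rewrite eval_difference //; last exact: coef_neq0.
rewrite -sub_ge0 opprK addrC /v addrA subrK sub_ge0; exact: ple.
Qed.

(** The quotient of the [j]-th power of the monomial [m] of [p] by the
    monomial [k] of [r].  The exponent [j] exceeds the degree of [k], so that
    the quotient has exactly the support of [m]; in the case of a trivial
    group of values this makes it vanish wherever the monomial [m] does. *)
Lemma quotient_monomial k : k \in finsupp r -> tangible (r k) ->
  (forall a, dominates p m a -> dominates r k a) ->
  exists j c e,
    (forall a, mono_eval c e a * mono_eval (r k) k a =
               mono_eval (p m) m a ^+ j) /\
    (forall a l, l \in finsupp r ->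
      ge_nu (poly_eval p a ^+ j) (mono_eval c e a * mono_eval (r l) l a)).
Proof.
move=> kr tk kdom.
have supp := dominator_support kr kdom.
have [j0 bnd] := full_point_bound kr kdom.
pose j := (j0 + mdeg k).+1.
have [u tu ku] := tangibleV _ tk.
pose e := (m *+ j - k)%MM.
have kmj i : (k i <= m i * j)%N.
  have [->//|/supp mi] := eqVneq (k i) 0%N.
  apply: leq_trans (_ : j <= _)%N; last by rewrite leq_pmull // lt0n.
  rewrite /j -addnS; apply: leq_trans (leq_addl _ _); apply: leqW.
  by rewrite mdegE (bigD1 i) //= leq_addr.
have ekE : (e + k)%MM = (m *+ j)%MM.
  by apply/mnmP => i; rewrite mnmDE mnmBE mulmnE subnK.
have qkE a : mono_eval (p m ^+ j * u) e a * mono_eval (r k) k a =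
    mono_eval (p m) m a ^+ j.
  by rewrite mono_evalM mono_evalX -ekE -mulrA [u * _]mulrC ku mulr1.
exists j, (p m ^+ j * u), e; split=> // a l lr.
have full b : (forall i, b i <> 0) ->
    ge_nu (poly_eval p b ^+ j) (mono_eval (p m ^+ j * u) e b * mono_eval (r l) l b).
  move=> b0; have := bnd j b l _ b0 lr.
  rewrite -qkE -mulrA mulrCA [X in ge_nu X _]mulrC.
  have jj : (j0 <= j)%N by rewrite /j -addnS leq_addr.
  move=> /(_ jj); apply: ge_nuM_cancel.
  by apply: mono_eval_full => //; exact: coef_neq0.
have [[t t0 t1]|flat] := nontrivial_or_flat F.
  have [s sE] : exists s : Defs.polynomial F n,
      forall b, poly_eval s b = poly_eval p b ^+ j.
    have pP : is_polyfun (poly_eval p) by apply/asboolP; exists p.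
    have /asboolP[s sE] := valP (Polyfun pP ^+ j).
    exists s => b; rewrite -sE; elim: (j) => [|i IH] //.
    by rewrite !exprS -IH.
  rewrite -sE mono_evalM; apply: (ge_nu_everywhere t0 t1) => b b0.
  by rewrite sE -mono_evalM; exact: full.
have [->|qh0] := pselect (mono_eval (p m ^+ j * u) e a * mono_eval (r l) l a = 0).
  exact: ge_nu0.
apply: flat => //; apply/exp_neq0/(poly_eval_neq0 mp).
apply/mono_eval_neq0; split; first exact: coef_neq0.
move=> i mi ai; apply: qh0.
suff -> : mono_eval (p m ^+ j * u) e a = 0 by rewrite mul0r.
apply: contrapT => /mono_eval_neq0[_ /(_ i)]; apply => //.
rewrite mnmBE mulmnE -lt0n subn_gt0.
apply: leq_trans (_ : j <= _)%N; last by rewrite leq_pmull // lt0n.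
rewrite /j ltnS; apply: leq_trans (leq_addl _ _).
by rewrite mdegE (bigD1 i) //= leq_addr.
Qed.

End Region.

(** * Assembling the power of f *)

Section Assembly.
Variables (F : supertropicalSemifieldType) (n : nat).
Implicit Types (f g : {polyfun F[n]}) (p : Defs.polynomial F n).

Definition mono_fun c m : {polyfun F[n]} := Polyfun (is_polyfun_mono c m).

Lemma polyfun_add f g a : (f + g) a = f a + g a. Proof. by []. Qed.

Lemma polyfun_mulE f g a : (f * g) a = f a * g a. Proof. by []. Qed.

Lemma polyfun_exp f j a : (f ^+ j) a = f a ^+ j.
Proof. by elim: j => [|j IH] //; rewrite !exprS -IH. Qed.

Lemma polyfun_sum (I : Type) (s : seq I) (P : pred I) (u : I -> {polyfun F[n]}) a :
  (\sum_(i <- s | P i) u i) a = \sum_(i <- s | P i) u i a.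
Proof. exact: (big_morph (fun f : {polyfun F[n]} => f a)). Qed.

(** The multiplier is [quotient_monomial] for the monomial of [g] that dominates
    on the whole component; its coefficient is tangible because [g] is. *)
Lemma monomial_multiplier f p m g : divisibly_closed F ->
  poly_eval p = f -> m \in finsupp p -> tangible (p m) -> (exists a, dominates p m a) ->
  preceq_on (component f (p m) m) g ->
  exists j (q : {polyfun F[n]}),
    (forall a, ge_nu (f a ^+ j) (q a * g a)) /\
    (forall a, dominates p m a -> q a * g a = mono_eval (p m) m a ^+ j).
Proof.
move=> divF pf mp tm ess gtan; have /asboolP[r rE] := valP g.
have gE a : g a = poly_eval r a by rewrite -rE.
have rdom a : dominates p m a ->
    exists2 k, k \in finsupp r & dominates r k a /\ tangible (r k).
  move=> /(dominates_component mp pf tm)[b ab bD].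
  have tgb : tangible (g b) by apply: gtan; exists b.
  rewrite gE in tgb; have [k kr [kb tk]] := tangible_dominated tgb.
  by exists k => //; split=> //; apply: dominates_congr kb => i; rewrite ab.
have [k kr kdom] : exists2 k, k \in finsupp r &
    forall a, dominates p m a -> dominates r k a.
  apply: constant_dominator => // a /rdom[k kr [ka _]]; by exists k.
have tk : tangible (r k).
  have [a ma] := ess; have [l lr [la tl]] := rdom a ma.
  by rewrite (dominates_uniq kr lr (kdom a ma) la).
have [j [c [e [qk qbnd]]]] := quotient_monomial divF mp ess kr tk kdom.
exists j, (mono_fun c e); split=> a.
  rewrite gE /poly_eval mulr_sumr -pf.
  by apply: sum_ge_nu => l lr _; exact: qbnd.
by move=> ma; rewrite gE (dominates_eval kr (kdom a ma)) -qk.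
Qed.

(** This supplies the [k]-th power of [p] where [p] does not vanish and no
    monomial with tangible coefficient dominates: there either a ghost
    monomial dominates, and its [k]-th power has the right value, or two
    monomials tie for the largest nu-value, and their mixed product has it.
    The factor [nu 1] makes the mixed products ghost. *)
Definition ghost_remainder p k : {polyfun F[n]} :=
  \sum_(m <- finsupp p | `[< ghost (p m) >]) mono_fun (p m) m ^+ k +
  \sum_(m <- finsupp p) \sum_(l <- finsupp p | l != m)
    mono_fun (nu 1) 0 * (mono_fun (p m) m ^+ k.-1 * mono_fun (p l) l).

Section GhostRemainder.
Variables (p : Defs.polynomial F n) (j : nat) (a : 'I_n -> F).
(* k is at least 2, so that both factors of a mixed product occur in it *)
Let k := j.+2.
Local Notation f := (poly_eval p a).
Local Notation T m := (mono_eval (p m) m a).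

Lemma ghost_remainderE :
  ghost_remainder p k a = \sum_(m <- finsupp p | `[< ghost (p m) >]) T m ^+ k +
    \sum_(m <- finsupp p) \sum_(l <- finsupp p | l != m)
      nu 1 * (T m ^+ k.-1 * T l).
Proof.
rewrite /ghost_remainder polyfun_add !polyfun_sum; congr (_ + _).
  by apply: eq_bigr => m _; rewrite polyfun_exp.
apply: eq_bigr => m _; rewrite polyfun_sum; apply: eq_bigr => l _.
rewrite !polyfun_mulE polyfun_exp; congr (_ * _).
by rewrite /= /mono_eval big1 ?mulr1 // => i _; rewrite mnm0E expr0.
Qed.

Lemma ghost_remainder_ghost : ghost (ghost_remainder p k a).
Proof.
rewrite ghost_remainderE; apply: ghostD; apply: ghost_sum => m gm.
  by apply: ghostX => //; apply: ghostMr; exact/asboolP.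
by apply: ghost_sum => l _; apply: ghostMr; exact: nu_ghost.
Qed.

Let nu1M (x : F) : nu x = nu (nu 1 * x).
Proof. by rewrite nuM nu_idem -nuM mul1r. Qed.

Lemma ghost_remainder_le : ge_nu (f ^+ k) (ghost_remainder p k a).
Proof.
rewrite ghost_remainderE; apply: ge_nuD; apply: sum_ge_nu => m mp _.
  exact/ge_nuX/poly_eval_ge.
apply: sum_ge_nu => l lp _; apply: ge_nu_congr erefl (nu1M _) _.
rewrite [f ^+ _]exprSr; apply: ge_nuM2; last exact: poly_eval_ge.
exact/ge_nuX/poly_eval_ge.
Qed.

Lemma ghost_remainder_lt m : m \in finsupp p -> dominates p m a ->
  tangible (p m) -> gt_nu (f ^+ k) (ghost_remainder p k a).
Proof.
move=> mp ma tm; have fm := dominates_eval mp ma.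
have lt_f l : l \in finsupp p -> l != m -> gt_nu f (T l).
  by move=> lp lm; rewrite fm; have /dominatesP[_] := ma; apply.
have f0 : f <> 0 by rewrite fm; have /dominatesP[] := ma.
have fk0 : f ^+ k <> 0 by exact: exp_neq0.
rewrite ghost_remainderE; apply: gt_nuD.
  apply: sum_gt_nu => // l lp /asboolP gl; apply: gt_nuX => //.
  by apply: lt_f => //; apply/eqP => lm; apply: tm; rewrite -lm.
apply: sum_gt_nu => // l lp _; apply: sum_gt_nu => // i ip il.
apply: gt_nu_congr erefl (nu1M _) _.
rewrite [f ^+ _]exprSr; have [lm|lm] := eqVneq l m; last first.
  have [->|Ti0] := pselect (T i = 0).
    by rewrite mulr0; apply/gt_nu0/mul_neq0 => //; exact: exp_neq0.
  by apply: gt_ge_nuM2; [|exact/gt_nuX/lt_f|exact: poly_eval_ge].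
have fi : gt_nu f (T i) by apply: lt_f => //; rewrite -lm.
by rewrite lm -fm; apply: gt_nuM => //; exact: exp_neq0.
Qed.

Lemma ghost_remainder_eq :
  ~ (exists m, [/\ m \in finsupp p, dominates p m a & tangible (p m)]) ->
  ghost_remainder p k a = f ^+ k.
Proof.
move=> nodom; have [f0|f0] := pselect (f = 0).
  have := ghost_remainder_le; rewrite f0 [0 ^+ _]exprS mul0r.
  by move/ge_nu_0eq.
suff [gf cf] : ghost f /\ ge_nu (ghost_remainder p k a) (f ^+ k).
  rewrite -[LHS]nu_ghost_id ?(ge_nu_anti cf ghost_remainder_le).
    by rewrite nu_ghost_id //; exact: ghostX.
  exact: ghost_remainder_ghost.
have [m mp mE] := sum_nu_attained f0.
have [ma|ma] := pselect (dominates p m a).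
  have fm := dominates_eval mp ma.
  have gm : ghost (p m) by apply: contrapT => tm; apply: nodom; exists m.
  rewrite fm; split; first exact: ghostMr.
  rewrite ghost_remainderE; apply: ge_nu_trans (ge_nuDl _ _) _.
  by apply: (ge_nu_sum (fun m => T m ^+ k) mp); exact/asboolP.
have Tm0 : T m <> 0 by move=> Tm0; apply/f0/nu_eq0; rewrite -mE Tm0 nu0.
have [l [lp lm ml]] : exists l, [/\ l \in finsupp p, l != m & ge_nu (T l) (T m)].
  apply: contrapT => nol; apply: ma; apply/dominatesP; split=> // l lp lm.
  by apply/gt_nuN => ml; apply: nol; exists l.
split.
  rewrite /poly_eval (bigD1_seq m mp (fset_uniq _)) /= addr_eq_nu.
    exact: nu_ghost.
  apply: ge_nu_anti.
    apply: (ge_nu_congr (esym mE) erefl); apply: sum_ge_nu => i ip _.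
    exact: poly_eval_ge.
  exact: ge_nu_trans (ge_nu_sum (fun l => T l) lp lm) ml.
rewrite ghost_remainderE addrC; apply: ge_nu_trans (ge_nuDl _ _) _.
apply: ge_nu_trans (ge_nu_sum _ mp isT) _.
apply: ge_nu_trans (ge_nu_sum _ lp lm) _.
apply: ge_nu_congr (nu1M _) erefl _.
rewrite [f ^+ _]exprSr; apply: ge_nuM2; first exact/ge_nuX/ge_nu_eq.
exact: ge_nu_trans ml (ge_nu_eq mE).
Qed.

End GhostRemainder.

(** Monomials that are inessential or have a ghost coefficient get the
    multiplier 0, their contribution being left to the remainder. *)
Lemma trop_radical_preceq_comp f (A : set {polyfun F[n]}) :
  divisibly_closed F -> semiring_ideal A -> preceq_comp f A ->
  trop_radical (@polyfun_ghost F n) A f.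
Proof.
move=> divF [A0 AD AM] fA; have /asboolP[p pf] := valP f.
have fE a : f a = poly_eval p a by rewrite -pf.
pose T m a := mono_eval (p m) m a.
have /choice[z zP] m : exists z : nat * {polyfun F[n]} * {polyfun F[n]},
    [/\ A z.2, forall a, ge_nu (f a ^+ z.1.1) (z.1.2 a * z.2 a)
      & m \in finsupp p -> tangible (p m) -> forall a, dominates p m a ->
          z.1.2 a * z.2 a = T m a ^+ z.1.1].
  have [[mp tm ess]|no] := pselect [/\ m \in finsupp p, tangible (p m)
      & exists a, dominates p m a].
    have [|g Ag gD] := fA (p m) m.
      by exists p; split=> //; split=> //; case: ess => a ?; exists a.
    have [j [q [bnd qg]]] := monomial_multiplier divF (esym pf) mp tm ess gD.
    by exists (j, q, g).
  exists (0%N, 0, 0); split=> // [a|mp tm a ma].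
    by rewrite mulr0; exact: ge_nu0.
  by case: no; split=> //; exists a.
have [||J Jz] := @uniform_bound _ (enum_fset (finsupp p))
    (fun m j => (z m).1.1 <= j)%N.
- by move=> m i j ij mi; exact: leq_trans ij.
- by move=> m _; exists (z m).1.1.
pose k := J.+2.
have kz m : m \in finsupp p -> ((z m).1.1 < k)%N.
  by move=> /Jz mJ; rewrite ltnS leqW.
(* the positive power of the monomial makes X m strictly smaller than f^k
   wherever the monomial is strictly smaller than f *)
pose X m : {polyfun F[n]} :=
  mono_fun (p m) m ^+ (k - (z m).1.1) * (z m).1.2 * (z m).2.
have XE m a : X m a = T m a ^+ (k - (z m).1.1) * ((z m).1.2 a * (z m).2 a).
  by rewrite /X !polyfun_mulE polyfun_exp mulrA.
have AX m : A (X m) by apply: AM; case: (zP m).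
clearbody X.
have fT m a : m \in finsupp p -> ge_nu (f a) (T m a).
  by rewrite fE; exact: poly_eval_ge.
have X_le a m : m \in finsupp p -> ge_nu (f a ^+ k) (X m a).
  move=> mp; rewrite XE -(subnK (ltnW (kz m mp))) exprD.
  rewrite addnK; apply: ge_nuM2; last by case: (zP m).
  exact/ge_nuX/fT.
have X_lt a m : m \in finsupp p -> gt_nu (f a) (T m a) ->
    gt_nu (f a ^+ k) (X m a).
  move=> mp fm; rewrite XE.
  have [->|qg0] := pselect ((z m).1.2 a * (z m).2 a = 0).
    by rewrite mulr0; apply/gt_nu0/exp_neq0/(gt_nu_neq0 fm).
  rewrite -{1}(subnK (ltnW (kz m mp))) exprD; apply: gt_ge_nuM2 => //.
    by apply: gt_nuX; rewrite // subn_gt0 kz.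
  by case: (zP m).
exists k => //; exists (\sum_(m <- finsupp p) X m); first exact: (big_ind A).
exists 1, (ghost_remainder p k); split=> [a|]; first exact: ghost_remainder_ghost.
rewrite mul1r; apply: polyfunP => a.
rewrite polyfun_exp polyfun_add polyfun_sum.
have [[m [mp ma tm]]|nodom] := pselect (exists m,
    [/\ m \in finsupp p, dominates p m a & tangible (p m)]).
  have fm : f a = T m a by rewrite fE (dominates_eval mp ma).
  have Xm : X m a = f a ^+ k.
    rewrite XE; have [_ _ ->] := zP m => //.
    by rewrite -exprD subnK ?fm // ltnW // kz.
  have fk0 : f a ^+ k <> 0.
    by apply: exp_neq0; rewrite fm; have /dominatesP[] := ma.
  rewrite (bigD1_seq m mp (fset_uniq _)) /= Xm -addrA addr_gt_nu //.
  apply: gt_nuD; last by rewrite fE; exact: ghost_remainder_lt ma tm.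
  apply: sum_gt_nu => // l lp lm; apply: X_lt => //.
  by rewrite fm; have /dominatesP[_] := ma; apply.
rewrite fE -(ghost_remainder_eq _ nodom) addrC addr_ghost //.
  exact: ghost_remainder_ghost.
rewrite (ghost_remainder_eq _ nodom) -fE.
by apply: sum_ge_nu => m mp _; exact: X_le.
Qed.

End Assembly.

Theorem theorem7p17 (F : supertropicalSemifieldType) (n : nat)
    (A : set {polyfun F[n]}) (f : {polyfun F[n]}) :
  divisibly_closed F -> archimedean F -> semiring_ideal A ->
  preceq_comp f A <-> trop_radical (@polyfun_ghost F n) A f.
Proof.
move=> divF _ idealA; split; first exact: trop_radical_preceq_comp.
move=> [k k0 [b Ab [q [c [gc fk]]]]] e m _; exists b => // _ [a [_ fa ta] <-] gb.
have : tangible ((f ^+ k) a) by rewrite polyfun_exp fa; exact: tangibleX.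
by apply; rewrite fk; apply: ghostD; [exact: ghostMl|exact: gc].
Qed.
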